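(* Let $F$ be a finite set equipped with the discrete $\sigma$-algebra. For a sequence $(x_i)\in F^{\mathbb{N}}$ and a subset $T\subseteq F$ put $$\mathsf{es}_F\bigl(T\,|\,(x_i)\bigr)=\lim_{n\to\infty}\frac{|\{i\le n\mid x_i\in T\}|}{n}$$ whenever this limit exists for all $T\subseteq F$, and leave $\mathsf{es}_F(\,\cdot\,|(x_i))$ undefined otherwise. Then $\mathsf{es}_F:F^{\mathbb{N}}\to F$ is an empirical sampling morphism for $F$ in $\mathsf{Partial}(\mathsf{BorelStoch})$.
   Context: $\mathbb{N}=\{1,2,3,\ldots\}$. $\mathsf{Partial}(\mathsf{BorelStoch})$ has standard Borel spaces as objects. A morphism $f:X\to Y$ is a partial Markov kernel: a measurable set $D_f\subseteq X$ (its domain) together with a Markov kernel $f(\cdot|x)$, $x\in D_f$, from $D_f$ to $Y$. The composite of $f:X\to Y$ and $g:Y\to Z$ has domain $D_{gf}=\{x\in D_f\mid f(D_g|x)=1\}$ and on it $(gf)(S|x)=\int_{D_g}g(S|y)\,f(dy|x)$. The tensor product of objects is the cartesian product with product $\sigma$-algebra; $f\otimes g$ for $f:A\to X$, $g:B\to Y$ has domain $D_f\times D_g$ and is given there by product measures. Two morphisms are equal iff they have the same domain and the same kernel on it. The Kolmogorov power $X^{\mathbb{N}}$ is the countable product with product $\sigma$-algebra. For a morphism $f:A\to X$, $f^{(\mathbb{N})}:A\to X^{\mathbb{N}}$ has domain $D_f$ and sends $a$ to the infinite product measure $f(\cdot|a)^{\otimes\mathbb{N}}$. For a finite permutation $\sigma$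 of $\mathbb{N}$ (a bijection fixing all but finitely many elements), $X^\sigma:X^{\mathbb{N}}\to X^{\mathbb{N}}$ is the (everywhere defined) deterministic kernel given by $(x_i)\mapsto(x_{\sigma(i)})$. A morphism $f:A\to X^{\mathbb{N}}\otimes Y$ is exchangeable in the first factor if $(X^\sigma\otimes \mathrm{id}_Y)\,f=f$ for every finite permutation $\sigma$. An empirical sampling morphism for $X$ is a morphism $\mathsf{es}:X^{\mathbb{N}}\to X$ (so in particular its domain is measurable and it is a Markov kernel on it) such that: (i) (permutation invariance) $\mathsf{es}\,X^\sigma=\mathsf{es}$ for every finite permutation $\sigma$ of $\mathbb{N}$; (ii) (empirical adequacy) for all objects $A,Y$ and every morphism $f:A\to X^{\mathbb{N}}\otimes Y$ exchangeable in the first factor, $(\mathsf{es}^{(\mathbb{N})}\otimes \mathrm{id}_Y)\,f=f$. *)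

(* Defs.v *)
From HB Require Import structures.
From mathcomp Require Import all_boot all_order all_algebra.
From mathcomp Require Import all_classical all_reals all_analysis.
From mathcomp Require Import measurable_realfun giry.

Set Implicit Arguments.
Unset Strict Implicit.
Unset Printing Implicit Defensive.

Import Order.TTheory GRing.Theory Num.Theory.
Import numFieldNormedType.Exports.

Local Open Scope classical_set_scope.
Local Open Scope ring_scope.

(* A [measurableType] is always inhabited.  In order to have the empty space as
   well, a measurable space is a measurable subset of a [measurableType],
   carrying the trace sigma-algebra; taking the full set gives back every
   [measurableType]. *)
Record mspace := MSpace {
  ms_disp : measure_display ;
  ambient :> measurableType ms_disp ;
  carrier : set ambient ;
  measurable_carrier : measurable carrier }.
Arguments carrier : clear implicits.
Arguments measurable_carrier : clear implicits.

(* Borel isomorphic to a (possibly empty) complete separable metric space;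
   completeness is the axiom of [completeType], which is a pointed structure. *)
Definition standard_borel (R : realType) (X : mspace) : Prop :=
  exists (M : metricType R) (f : M -> X),
    [/\ forall G : set_system M, ProperFilter G -> cauchy G ->
          exists x : M, G --> x,
        exists2 S : set M, countable S & dense S,
        injective f,
        range f = carrier X
      & forall B : set M, <<s (@open M) >> B <-> measurable (f @` B)].

Definition ms_prod (X Y : mspace) : mspace :=
  @MSpace _ (X * Y)%type (carrier X `*` carrier Y)
    (measurableX (measurable_carrier X) (measurable_carrier Y)).

Definition seq_cylinders d (T : measurableType d) : set (set (nat -> T)) :=
  [set C | exists i (A : set T), measurable A /\ C = [set x | A (x i)]].

Definition seq_measurableType d (T : measurableType d) :=
  g_sigma_algebraType (@seq_cylinders d T).

Lemma measurable_seq_coord d (T : measurableType d) i (A : set T) :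
  measurable A -> measurable ([set x | A (x i)] : set (seq_measurableType T)).
Proof. by move=> mA; apply: sub_sigma_algebra; exists i, A. Qed.

Definition seq_carrier (X : mspace) : set (seq_measurableType X) :=
  [set x | forall i, carrier X (x i)].
Arguments seq_carrier : clear implicits.

Lemma measurable_seq_carrier (X : mspace) : measurable (seq_carrier X).
Proof.
rewrite (_ : seq_carrier X = \bigcap_i [set x | carrier X (x i)]).
  apply: bigcapT_measurable => i; apply: measurable_seq_coord.
  exact: measurable_carrier.
by apply/seteqP; split => [x Xx i _|x Xx i]; exact: Xx.
Qed.

(* Sequences are indexed from 0: x_1, x_2, ... is x 0, x 1, ... *)
Definition ms_seq (X : mspace) : mspace :=
  @MSpace _ (seq_measurableType X) (seq_carrier X) (@measurable_seq_carrier X).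

(* A partial Markov kernel from [X] to [Y].  Only the values of [pker] on [pdom]
   are relevant, and there they are probabilities carried by [Y].  Outside of
   [pdom], the integral defining a composite may have mass less than 1, hence
   the type of subprobabilities.  Equality of morphisms is [pk_eq]. *)
Record pkernel (R : realType) (X Y : mspace) := PKernel {
  pdom : set X ;
  pker :> X -> subprobability Y R ;
  pdom_sub : pdom `<=` carrier X ;
  measurable_pdom : measurable pdom ;
  pker_carrier : forall x, pdom x -> pker x (carrier Y) = 1%E ;
  measurable_pker : forall U, measurable U ->
    measurable_fun pdom (fun x => pker x U) }.

Definition pk_eq (R : realType) (X Y : mspace) (f g : pkernel R X Y) : Prop :=
  pdom f = pdom g /\
  forall x, pdom f x -> forall U, measurable U -> f x U = g x U.

Section composition_measure.
Local Open Scope ereal_scope.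
Context d1 d2 (T1 : measurableType d1) (T2 : measurableType d2) (R : realType).
Variables (mu : subprobability T1 R) (D : set T1) (k : T1 -> subprobability T2 R).
Hypotheses (mD : measurable D)
  (mk : forall U, measurable U -> measurable_fun D (fun y => k y U)).

(* The proofs are arguments so that the measure instances can be inferred. *)
Definition comp_measure
    of measurable D & (forall U, measurable U -> measurable_fun D (k ^~ U)) :=
  fun U : set T2 => \int[mu]_(y in D) k y U.

Let comp0 : comp_measure mD mk set0 = 0.
Proof. by apply: integral0_eq => y _; rewrite measure0. Qed.

Let comp_ge0 U : 0 <= comp_measure mD mk U.
Proof. by apply: integral_ge0 => y _; exact: measure_ge0. Qed.

Let comp_semi_sigma_additive : semi_sigma_additive (comp_measure mD mk).
Proof.
move=> U mU tU mUU; rewrite [X in _ --> X](_ : _ =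
    \sum_(n <oo) comp_measure mD mk (U n)); last first.
  rewrite /comp_measure -integral_nneseries//; last by move=> n; exact: mk.
  by apply: eq_integral => y _; rewrite measure_semi_bigcup.
by apply: is_cvg_nneseries => n _ _; exact: comp_ge0.
Qed.

HB.instance Definition _ := isMeasure.Build _ _ _ (comp_measure mD mk)
  comp0 comp_ge0 comp_semi_sigma_additive.

Let comp_setT : comp_measure mD mk setT <= 1.
Proof.
apply: (@le_trans _ _ (\int[mu]_(y in D) 1)).
  apply: ge0_le_integral => //; first exact: mk.
  by move=> y _; exact: sprobability_setT.
rewrite integral_cst// mul1e (le_trans _ (@sprobability_setT _ _ _ mu))//.
by rewrite le_measure ?inE.
Qed.

HB.instance Definition _ :=
  Measure_isSubProbability.Build _ _ _ (comp_measure mD mk) comp_setT.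

Definition comp_subprobability : subprobability T2 R := comp_measure mD mk.

End composition_measure.

Lemma measurable_fun_setI1 d1 (T1 : measurableType d1) (R : realType)
    (D : set T1) (f : T1 -> \bar R) :
  measurable D -> measurable_fun D f -> measurable (D `&` [set x | f x = 1%E]).
Proof. by move=> mD mf; exact: (mf mD [set 1%E] (emeasurable_set1 _)). Qed.

Section composition.
Local Open Scope ereal_scope.
Context (R : realType) (X Y Z : mspace).
Variables (g : pkernel R Y Z) (f : pkernel R X Y).

Definition pcomp_dom : set X := pdom f `&` [set x | f x (pdom g) = 1].

Definition pcomp_ker (x : X) : subprobability Z R :=
  comp_subprobability (f x) (@measurable_pdom _ _ _ g) (@measurable_pker _ _ _ g).

Lemma pcomp_kerE x U : pcomp_ker x U = \int[f x]_(y in pdom g) g y U.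
Proof. by []. Qed.

Lemma measurable_pcomp_dom : measurable pcomp_dom.
Proof.
apply: measurable_fun_setI1; first exact: measurable_pdom.
exact: measurable_pker (measurable_pdom g).
Qed.

Lemma pcomp_carrier x : pcomp_dom x -> pcomp_ker x (carrier Z) = 1.
Proof.
move=> [_ fx1]; rewrite pcomp_kerE.
transitivity (\int[f x]_(y in pdom g) (1 : \bar R)).
  by apply: eq_integral => y; rewrite inE => /pker_carrier.
by rewrite integral_cst ?mul1e//; exact: measurable_pdom.
Qed.

Lemma measurable_pcomp U : measurable U ->
  measurable_fun pcomp_dom (fun x => pcomp_ker x U).
Proof.
move=> mU.
pose l x : {measure set Y -> \bar R} :=
  if x \in pdom f then f x : {measure set Y -> \bar R} else mzero.
have ml V : measurable V -> measurable_fun setT (l ^~ V).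
  move=> mV.
  have -> : (l ^~ V) = (fun x => f x V) \_ (pdom f).
    by apply/funext => x; rewrite /l patchE; case: ifPn.
  apply/(measurable_restrictT _ (@measurable_pdom _ _ _ f)).
  exact: measurable_pker.
pose k := (fun y => g y U) \_ (pdom g).
have k0 y : 0 <= k y by rewrite /k patchE; case: ifPn.
have mk : measurable_fun setT k.
  apply/(measurable_restrictT _ (@measurable_pdom _ _ _ g)).
  exact: measurable_pker.
have := measurable_fun_integral_kernel ml k0 mk.
move=> /(@measurable_funS _ _ _ _ _ pcomp_dom _ measurableT (@subsetT _ _)).
apply: eq_measurable_fun => x; rewrite inE => -[fx _].
by rewrite /l mem_set// pcomp_kerE [RHS]integral_mkcond.
Qed.

Definition pcomp : pkernel R X Z :=
  @PKernel R X Z pcomp_dom pcomp_ker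
    (subset_trans (@subIsetl _ _ _) (@pdom_sub _ _ _ f))
    measurable_pcomp_dom pcomp_carrier measurable_pcomp.

End composition.

Section deterministic.
Context (R : realType) (X Y : mspace) (phi : X -> Y).

Definition pdet_ker (x : X) : subprobability Y R := dirac (phi x).

Lemma pdet_carrier : {homo phi : x / carrier X x >-> carrier Y x} ->
  forall x, carrier X x -> pdet_ker x (carrier Y) = 1%E.
Proof. by move=> phiXY x /phiXY Yx; rewrite /pdet_ker/= diracE mem_set. Qed.

Lemma measurable_pdet : measurable_fun (carrier X) phi ->
  forall U, measurable U ->
  measurable_fun (carrier X) (fun x => pdet_ker x U).
Proof.
move=> mphi U mU; rewrite /pdet_ker/=.
apply: (@measurableT_comp _ _ _ _ _ _ (fun y : Y => \d_y U)%E) => //.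
apply/measurable_EFinP; exact: measurable_indic.
Qed.

Definition pdet (homo_phi : {homo phi : x / carrier X x >-> carrier Y x})
    (mphi : measurable_fun (carrier X) phi) : pkernel R X Y :=
  @PKernel R X Y (carrier X) pdet_ker (@subset_refl _ _) (measurable_carrier X)
    (pdet_carrier homo_phi) (measurable_pdet mphi).

End deterministic.

Definition pid (R : realType) (X : mspace) : pkernel R X X :=
  @pdet R X X idfun (fun _ Xx => Xx) (@measurable_id _ _ _).

Section reindexing.
Context (R : realType) (X : mspace) (s : nat -> nat).

Definition seq_reindex (x : ms_seq X) : ms_seq X := fun i => x (s i).

Lemma homo_seq_reindex :
  {homo seq_reindex : x / carrier (ms_seq X) x >-> carrier (ms_seq X) x}.
Proof. by move=> x Xx i; exact: Xx. Qed.

Lemma measurable_seq_reindex :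
  measurable_fun (carrier (ms_seq X)) seq_reindex.
Proof.
apply: (@measurable_funS _ _ _ _ setT) => //.
apply: (@measurability _ _ (ms_seq X) (ms_seq X) setT seq_reindex
  (@seq_cylinders _ X)) => //.
move=> _ [_ [i [A [mA ->]] <-]]; rewrite setTI.
exact: (measurable_seq_coord (s i) mA).
Qed.

(* (x_i) |-> (x_(s i)) *)
Definition preindex : pkernel R (ms_seq X) (ms_seq X) :=
  @pdet R (ms_seq X) (ms_seq X) seq_reindex homo_seq_reindex
    measurable_seq_reindex.

End reindexing.

Section tensor.
Local Open Scope ereal_scope.
Context (R : realType) (A X B Y : mspace).
Variables (f : pkernel R A X) (g : pkernel R B Y).

Definition ptensor_ker (ab : ms_prod A B) : subprobability (ms_prod X Y) R :=
  product_subprobability (f ab.1, g ab.2).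

Lemma ptensor_kerE ab U : ptensor_ker ab U = (f ab.1 \x g ab.2) U.
Proof. by []. Qed.

Lemma ptensor_sub : pdom f `*` pdom g `<=` carrier (ms_prod A B).
Proof. by move=> ab [/= /pdom_sub fa /pdom_sub gb]; split. Qed.

Lemma measurable_ptensor_dom : measurable (pdom f `*` pdom g).
Proof. by apply: measurableX; exact: measurable_pdom. Qed.

Lemma ptensor_carrier ab : (pdom f `*` pdom g) ab ->
  ptensor_ker ab (carrier (ms_prod X Y)) = 1.
Proof.
move=> [/= fa gb].
have -> : ptensor_ker ab (carrier (ms_prod X Y)) =
    f ab.1 (carrier X) * g ab.2 (carrier Y).
  by apply: product_measure1E; exact: measurable_carrier.
by rewrite !pker_carrier// mule1.
Qed.

Let measurable_giry d1 d2 (T1 : measurableType d1) (T2 : measurableType d2)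
    (D : set T1) (k : T1 -> giry T2 R) : measurable D ->
  (forall U, measurable U -> measurable_fun D (fun x => k x U)) ->
  measurable_fun setT (fun x => if x \in D then k x else mzero : giry T2 R).
Proof.
move=> mD mk; apply: measurable_giry_codensity => [//|U mU].
rewrite (_ : (fun _ => _) = (fun x => k x U) \_ D).
  by apply/(measurable_restrictT _ mD); exact: mk.
by apply/funext => x; rewrite patchE; case: ifPn.
Qed.

Lemma measurable_ptensor U : measurable U ->
  measurable_fun (pdom f `*` pdom g) (fun ab => ptensor_ker ab U).
Proof.
move=> mU.
have mf := measurable_giry (@measurable_pdom _ _ _ f) (@measurable_pker _ _ _ f).
have mg := measurable_giry (@measurable_pdom _ _ _ g) (@measurable_pker _ _ _ g).
have mfg := measurable_fun_pair (measurableT_comp mf (@measurable_fst _ _ A B))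
  (measurableT_comp mg (@measurable_snd _ _ A B)).
have := measurableT_comp (measurable_giry_ev mU)
  (measurableT_comp measurable_giry_prod mfg).
move=> /(@measurable_funS _ _ _ _ _ (pdom f `*` pdom g) _ measurableT
  (@subsetT _ _)).
by apply: eq_measurable_fun => ab; rewrite inE => -[/= fa gb]; rewrite !mem_set.
Qed.

Definition ptensor : pkernel R (ms_prod A B) (ms_prod X Y) :=
  @PKernel R (ms_prod A B) (ms_prod X Y) (pdom f `*` pdom g) ptensor_ker
    ptensor_sub measurable_ptensor_dom ptensor_carrier measurable_ptensor.

End tensor.

(* [h] is the Kolmogorov power f^(N): [h a] is the infinite product measure of
   copies of [f a], characterized (uniquely) by its values on cylinders. *)
Definition is_seq_power (R : realType) (A X : mspace)
    (f : pkernel R A X) (h : pkernel R A (ms_seq X)) : Prop :=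
  pdom h = pdom f /\
  forall a, pdom f a -> forall (n : nat) (B : nat -> set X),
    (forall i, measurable (B i)) ->
    h a [set x | forall i, (i < n)%N -> B i (x i)] =
      (\prod_(i < n) f a (B i))%E.

Definition finite_perm (s : nat -> nat) : Prop :=
  bijective s /\ finite_set [set i | s i != i].

Definition exchangeable (R : realType) (A X Y : mspace)
    (f : pkernel R A (ms_prod (ms_seq X) Y)) : Prop :=
  forall s, finite_perm s ->
    pk_eq (pcomp (ptensor (preindex R X s) (pid R Y)) f) f.

Definition permutation_invariant (R : realType) (X : mspace)
    (es : pkernel R (ms_seq X) X) : Prop :=
  forall s, finite_perm s -> pk_eq (pcomp es (preindex R X s)) es.

(* [esN] is determined by [es] up to [pk_eq]; its existence is part of the
   property. *)
Definition empirically_adequate (R : realType) (X : mspace)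
    (es : pkernel R (ms_seq X) X) : Prop :=
  exists2 esN : pkernel R (ms_seq X) (ms_seq X), is_seq_power es esN &
    forall A Y : mspace, standard_borel R A -> standard_borel R Y ->
    forall f : pkernel R A (ms_prod (ms_seq X) Y), exchangeable f ->
      pk_eq (pcomp (ptensor esN (pid R Y)) f) f.

Definition empirical_sampling (R : realType) (X : mspace)
    (es : pkernel R (ms_seq X) X) : Prop :=
  permutation_invariant es /\ empirically_adequate es.

(* The proportion of the first [n] terms of [x] that are in [T]. *)
Definition frequency (R : realType) (X : Type) (T : set X) (x : nat -> X)
    (n : nat) : R :=
  #|[pred i : 'I_n | x i \in T]|%:R / n%:R.

(* Main.v *)
Require Import Defs.
From HB Require Import structures.
From mathcomp Require Import all_boot all_order all_algebra.
From mathcomp Require Import all_classical all_reals all_analysis.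
From mathcomp Require Import measurable_realfun ring lra.
Import Order.TTheory GRing.Theory Num.Theory.
Import numFieldNormedType.Exports.

Set Implicit Arguments.
Unset Strict Implicit.
Unset Printing Implicit Defensive.

Local Open Scope classical_set_scope.
Local Open Scope ring_scope.

(** Kernels here are compared pointwise, so fix a point of the domain of a
    kernel [f] that is exchangeable in its first factor, and let [mu] be the law
    of a pair [(x, y)] that [f] attaches to this point: exchangeability says that
    [mu] is unchanged when the coordinates of [x] are permuted
    ([exchangeable_invariant]). Adequacy of [es] amounts to two facts about [mu].

    The limiting frequencies of [x] exist almost surely
    ([exchangeable_es_dom]); otherwise the composite would lose part of its
    domain. For a subset [B] the moments [E xi_i xi_j] of the indicators
    [xi_i = 1_B (x_i)] depend only on whether [i = j], whence
    [E (A_m - A_n)^2 = C (1/n - 1/m)] for the means [A_n] of the [xi_i]. Along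
    the cubes these differences are summable, so the subsequence converges almost
    surely; since consecutive cubes have ratio tending to [1], so do all the
    means ([ae_cvg_mean]).

    Conditionally on the limiting frequencies and on [y], the coordinates are
    independent with these frequencies as law
    ([exchangeable_rectangle]). In the expectation of
    [1_V (y) 1_(B_0) (x_0) ... 1_(B_(n-1)) (x_(n-1))] the coordinate [x_k] may be
    exchanged with any [x_j] for [j >= k] without affecting the other factors,
    as frequencies are invariant too; averaging over [j] and passing to the limit
    replaces [1_(B_k) (x_k)] by the limiting frequency of [B_k]. Doing so for
    [k = n-1, ..., 0] computes [mu] on rectangles, which determine it
    ([eq_measure_rectangles]).

    The Kolmogorov power of [es] has to be constructed. For a law on
    finitely many letters, cut [ ]0, 1] ] into intervals as long as the
    probabilities of the letters; the letter of a uniform point and the rescaled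
    position of the point in its interval are independent, and the latter is again
    uniform, so iterating produces an independent sequence
    ([exists_iid_sequence]).

    Finally, [es] is permutation invariant because a finite permutation does not
    change the frequencies among the first [n] terms once [n] is large
    ([frequency_finite_perm]). *)

(** * Means and empirical frequencies *)

Section means.
Context (R : realType).
Implicit Types a : nat -> R.

Definition mean a n : R := n%:R^-1 * \sum_(i < n) a i.

Lemma mean_itv01 a n : (forall i, 0 <= a i <= 1) -> 0 <= mean a n <= 1.
Proof.
move=> a01; rewrite mulr_ge0 ?sumr_ge0//=; last by move=> i _; case/andP: (a01 i).
case: n => [|n]; first by rewrite /mean invr0 mul0r.
rewrite /mean mulrC ler_pdivrMr// mul1r.
rewrite (le_trans (y := \sum_(i < n.+1) (1 : R)))//.
  by apply: ler_sum => i _; case/andP: (a01 i).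
by rewrite sumr_const card_ord.
Qed.

(** The mean of the first [m] terms is the average of the means of the first [n]
    and of the other [m - n], with weights [n / m] and [1 - n / m]. *)
Lemma mean_dist a n m : (forall i, 0 <= a i <= 1) -> (0 < n <= m)%N ->
  `|mean a m - mean a n| <= 1 - n%:R / m%:R.
Proof.
move=> a01 /andP[n0 nm].
have m0 : (0 < m)%N by rewrite (leq_trans n0).
have [d mE] : exists d, m = (n + d)%N by exists (m - n)%N; rewrite subnKC.
pose b i := a (n + i)%N.
have b01 i : 0 <= b i <= 1 by exact: a01.
have meanD : mean a m = n%:R / m%:R * mean a n + (1 - n%:R / m%:R) * mean b d.
  rewrite /mean mE big_split_ord/=.
  have [->|d0] := posnP d.
    rewrite addn0 !big_ord0 !mulr0 !addr0; field.
    by rewrite pnatr_eq0 -lt0n.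
  rewrite natrD; field; rewrite -natrD !pnatr_eq0 -!lt0n n0 d0.
  by rewrite addn_gt0 n0.
have t1 : 0 <= (n%:R / m%:R : R) <= 1.
  by rewrite divr_ge0//= ler_pdivrMr ?ltr0n// mul1r ler_nat.
move: meanD t1 (mean_itv01 n a01) (mean_itv01 d b01).
move: (mean a m) (mean a n) (mean b d) (n%:R / m%:R) => A B C t ->.
move=> /andP[t0 t1] /andP[B0 B1] /andP[C0 C1].
have -> : t * B + (1 - t) * C - B = (1 - t) * (C - B) by ring.
rewrite normrM ger0_norm ?subr_ge0// ler_piMr ?subr_ge0//.
by rewrite ler_norml; apply/andP; split; lra.
Qed.

(** Consecutive cubes have ratio tending to [1], so that by [mean_dist] the mean
    hardly moves between two of them. The exponent is a compromise: squares have
    the same property, but along cubes the variances in [integral_jump] can be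
    summed with rational weights. *)
Lemma cvg_mean_cubes a : (forall i, 0 <= a i <= 1) ->
  cvgn (fun k => mean a (k.+1 ^ 3)) -> cvgn (mean a).
Proof.
move=> a01 /cvg_ex[/= l ml]; apply/cvg_ex; exists l.
apply/cvgrPdist_le => /= e e0.
have e20 : 0 < e / 2 by rewrite divr_gt0.
have [K _ mK] : \forall k \near \oo, `|l - mean a (k.+1 ^ 3)| <= e / 2.
  by move/cvgrPdist_le : ml; apply.
have [K' _ hK'] : \forall k \near \oo, 3 / k.+1%:R <= e / 2.
  have : 3 * (harmonic k : R) @[k --> \oo] --> (3 * 0 : R).
    by apply: cvgMl_tmp; exact: cvg_harmonic.
  rewrite mulr0 => /cvgrPdist_le /(_ _ e20).
  apply: filterS => k; rewrite sub0r normrN /harmonic /= => H.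
  by rewrite (le_trans _ H)// ler_norm.
exists ((maxn K K').+1 ^ 3)%N => // n /= nK.
have [k /andP[kK nk]] : exists k, (maxn K K' <= k)%N && (k.+1 ^ 3 <= n < k.+2 ^ 3)%N.
  have ex : exists k, (maxn K K' <= k)%N && (k.+1 ^ 3 <= n)%N.
    by exists (maxn K K'); rewrite leqnn.
  have ub k : (maxn K K' <= k)%N && (k.+1 ^ 3 <= n)%N -> (k <= n)%N.
    move=> /andP[_ kn]; rewrite (leq_trans _ kn)// (leq_trans (leqnSn k))//.
    by rewrite -[leqLHS]expn1 leq_pexp2l.
  case: (ex_maxnP ex ub) => k /andP[Kk kn] maxk; exists k; rewrite Kk kn/=.
  rewrite ltnNge; apply/negP => nk.
  by have := maxk k.+1; rewrite nk (leq_trans Kk)// => /(_ isT); rewrite ltnn.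
move: kK; rewrite geq_max => /andP[/mK/= mk /hK'/= hk].
move/andP: nk => [kn nk].
rewrite [e]splitr -(subrK (mean a (k.+1 ^ 3)) l) -addrA (le_trans (ler_normD _ _))//.
have kn3 : (0 < k.+1 ^ 3 <= n)%N by rewrite expn_gt0.
rewrite lerD// distrC (le_trans (mean_dist a01 kn3))//.
(* Here [1 - t ^ 3 <= 3 (1 - t)], where [t] is the ratio of the cube roots. *)
pose t : R := k.+1%:R / k.+2%:R.
have t0 : 0 <= t by rewrite divr_ge0.
have t1 : 1 - t = k.+2%:R^-1.
  rewrite /t; apply: (@mulIf _ (k.+2%:R : R)); first by rewrite pnatr_eq0.
  by rewrite mulrBl -mulrA mulVf ?pnatr_eq0// mulr1 mul1r -natrB// subSnn.
have t2 : 0 <= 1 - t by rewrite t1 invr_ge0.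
rewrite (le_trans (y := 3 * (1 - t)))//; last first.
  by rewrite t1 (le_trans _ hk)// ler_pM2l// lef_pV2 ?posrE// ler_nat.
rewrite (le_trans (y := 1 - t ^+ 3))//; last first.
  rewrite -subr_ge0.
  have -> : 3 * (1 - t) - (1 - t ^+ 3) = (1 - t) ^+ 2 * (2 + t) by ring.
  by rewrite mulr_ge0 ?sqr_ge0// addr_ge0.
rewrite lerB// /t expr_div_n -!natrX ler_pM2l ?ltr0n ?expn_gt0//.
rewrite lef_pV2 ?posrE ?ltr0n ?expn_gt0//; last first.
  by rewrite (leq_trans _ kn)// expn_gt0.
by rewrite ler_nat ltnW.
Qed.
End means.

Section frequencies.
Context (R : realType).

Lemma frequencyE (X : Type) (T : set X) (x : nat -> X) n :
  frequency R T x n = n%:R^-1 * \sum_(i < n) \1_T (x i).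
Proof.
rewrite /frequency mulrC; congr (_ * _).
by rewrite -sum1_card natr_sum big_mkcond/=; apply: eq_bigr => i _;
  rewrite indicE inE; case: (_ \in _).
Qed.

Lemma frequency_mean (X : Type) (T : set X) (x : nat -> X) :
  frequency R T x = mean (fun i => \1_T (x i)).
Proof. by apply/funext => n; exact: frequencyE. Qed.

Lemma indic_itv01 (X : Type) (T : set X) (a : X) : 0 <= (\1_T a : R) <= 1.
Proof. by rewrite indicE; case: (_ \in _) => /=; rewrite ?lexx ?ler01. Qed.

Lemma frequency_ge0 (X : Type) (T : set X) (x : nat -> X) n :
  0 <= frequency R T x n.
Proof. by rewrite divr_ge0. Qed.

Lemma frequency_le1 (X : Type) (T : set X) (x : nat -> X) n :
  frequency R T x n <= 1.
Proof.
case: n => [|n]; first by rewrite /frequency invr0 mulr0.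
by rewrite ler_pdivrMr// mul1r ler_nat (leq_trans (max_card _))// card_ord.
Qed.

Lemma frequency_full (X : Type) (T : set X) (x : nat -> X) n :
  (forall i, T (x i)) -> frequency R T x n.+1 = 1.
Proof.
move=> Tx; rewrite frequencyE (eq_bigr (fun=> 1)) => [|i _].
  by rewrite sumr_const card_ord mulVf// pnatr_eq0.
by rewrite indicE mem_set.
Qed.

Lemma frequency_atoms (X : eqType) (r : seq X) (T : set X) (x : nat -> X) n :
  uniq r -> (forall i, x i \in r) ->
  frequency R T x n = \sum_(k <- r) frequency R [set k] x n * \1_T k.
Proof.
move=> ur xr; rewrite frequencyE.
under [RHS]eq_bigr do rewrite frequencyE -mulrA.
rewrite -big_distrr/=; congr (_ * _).
under [RHS]eq_bigr do rewrite big_distrl/=.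
rewrite exchange_big/=; apply: eq_bigr => i _.
rewrite (bigD1_seq (x i))//= [\1_[set x i] _]indicE mem_set// mul1r.
rewrite big1 ?addr0// => k kx.
by rewrite indicE memNset ?mul0r//= => /esym/eqP; apply/negP.
Qed.

(** Once [n] exceeds every index moved by [s], [s] permutes the indices
    below [n]. *)
Lemma frequency_finite_perm (X : Type) (s : nat -> nat) (T : set X)
    (x : nat -> X) : finite_perm s ->
  \forall n \near \oo, frequency R T (x \o s) n = frequency R T x n.
Proof.
move=> [/bij_inj sI /finite_seqP[r rE]].
pose N := (\max_(i <- r) i).+1.
have sN i : (N <= i)%N -> s i = i.
  move=> Ni; apply/eqP/negPn/negP => si.
  have : i \in r by have : [set i | s i != i] i by []; rewrite rE.
  by move=> /(@leq_bigmax_seq nat _ xpredT id _)/(_ isT); rewrite leqNgt Ni.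
exists N => // n /= Nn.
have sn (i : 'I_n) : (s i < n)%N.
  rewrite ltnNge; apply/negP => nsi.
  by have := sN _ (leq_trans Nn nsi) => /sI si; move: nsi; rewrite si leqNgt ltn_ord.
rewrite !frequencyE; congr (_ * _).
rewrite [RHS](reindex_inj (h := fun i => Ordinal (sn i)))//= => i j [] /sI ij.
exact: val_inj.
Qed.

Lemma frequency_finite_perm_cvg (X : Type) (s : nat -> nat) (T : set X)
    (x : nat -> X) (l : R) : finite_perm s ->
  frequency R T (x \o s) @ \oo --> l <-> frequency R T x @ \oo --> l.
Proof.
move=> fs; have xs := frequency_finite_perm T x fs.
split; apply: cvg_trans; apply: near_eq_cvg; near=> n; [|symmetry];
  by near: n.
Unshelve. all: end_near. Qed.

End frequencies.

(** * Measures on sequence spaces *)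

Section cylinders.
Context d (T : measurableType d).
Local Notation X := (seq_measurableType T).

Definition cylinder n (B : nat -> set T) : set X :=
  [set x | forall i, (i < n)%N -> B i (x i)].

Lemma measurable_coord i : measurable_fun setT (fun x : X => x i).
Proof. by move=> _ A mA; rewrite setTI; exact: measurable_seq_coord. Qed.

Lemma measurable_cylinder (B : nat -> set T) n : (forall i, measurable (B i)) ->
  measurable (cylinder n B).
Proof.
move=> mB.
rewrite (_ : cylinder n B = \bigcap_(i in `I_n) [set x : X | B i (x i)]).
  by apply: fin_bigcap_measurable => // i _; exact: measurable_seq_coord.
by apply/seteqP; split.
Qed.

Lemma prod_indic (R : realType) (B : nat -> set T) n (x : X) :
  \prod_(i < n) \1_(B i) (x i) = \1_(cylinder n B) x :> R.
Proof.
rewrite [RHS]indicE; have [Bx|nBx] := pselect (forall i, (i < n)%N -> B i (x i)).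
  by rewrite mem_set// big1// => i _; rewrite indicE mem_set//; exact: Bx.
rewrite memNset//; have /existsNP[i /not_implyP[ni nBi]] := nBx.
by rewrite (bigD1 (Ordinal ni))//= indicE memNset// mul0r.
Qed.

Definition cylinders : set (set X) :=
  [set C | exists n B, (forall i, measurable (B i)) /\ C = cylinder n B].

Lemma setI_closed_cylinders : setI_closed cylinders.
Proof.
move=> _ _ [n [B [mB ->]]] [m [C [mC ->]]].
pose D i := (if (i < n)%N then B i else setT) `&` (if (i < m)%N then C i else setT).
exists (maxn n m), D; split.
  by move=> i; apply: measurableI; case: ifP.
apply/seteqP; split => x /=.
  move=> [Bx Cx] i _; rewrite /D; split; case: ifP => //; [exact: Bx|exact: Cx].
move=> Dx; split => i ni; have := Dx i; rewrite leq_max ni ?orbT => /(_ isT).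
  by move=> []; rewrite ni.
by move=> []; rewrite ni.
Qed.

Lemma measurable_cylinders : @measurable _ X = <<s cylinders >>.
Proof.
apply/seteqP; split.
  apply: smallest_sub; first exact: smallest_sigma_algebra.
  move=> _ [i [A [mA ->]]]; apply: sub_sigma_algebra.
  exists i.+1, (fun j => if j == i then A else setT); split.
    by move=> j; case: ifP.
  apply/seteqP; split => x /=; first by move=> Ax j _; case: eqVneq => // ->.
  by move=> /(_ i (ltnSn i)); rewrite eqxx.
apply: smallest_sub; first exact: sigma_algebra_measurable.
by move=> _ [n [B [mB ->]]]; exact: measurable_cylinder.
Qed.

Lemma cylinders_setT : cylinders setT.
Proof.
exists 0%N, (fun=> setT); split => //.
by apply/seteqP; split.
Qed.

(** The sets [U] for which [h x U] is measurable in [x] form a Dynkin system. *)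
Lemma measurable_fun_probability_cylinders d' (S : measurableType d')
    (R : realType) (D : set S) (h : S -> probability X R) : measurable D ->
  (forall n B, (forall i, measurable (B i)) ->
    measurable_fun D (fun x => h x (cylinder n B))) ->
  forall U, measurable U -> measurable_fun D (fun x => h x U).
Proof.
move=> mD hC U; rewrite measurable_cylinders.
apply: (@dynkin_induction _ X cylinders
  [set U | measurable_fun D (fun x => h x U)]) => //=.
- exact: measurable_cylinders.
- exact: setI_closed_cylinders.
- by under eq_fun do rewrite probability_setT; exact: measurable_cst.
- by move=> _ [n [B [mB ->]]]; exact: hC.
- move=> A mA hA; under eq_fun do rewrite probability_setC//.
  exact: emeasurable_funB.
- move=> A mA tA hA.
  have -> : (fun x => h x (\bigcup_k A k)) = (fun x => \sum_(k <oo) h x (A k))%E.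
    by apply/funext => x; rewrite measure_semi_bigcup//; exact: bigcup_measurable.
  apply: ge0_emeasurable_sum => //.
Qed.

(** For each [V], the measures [m1 (A * V)] and [m2 (A * V)] in [A] agree on
    cylinders, a generating system stable under intersection; so [m1] and [m2]
    agree on measurable rectangles. *)
Lemma eq_measure_rectangles d' (Y : measurableType d') (R : realType)
    (m1 m2 : subprobability (X * Y)%type R) :
  (forall n B V, (forall i, measurable (B i)) -> measurable V ->
    m1 (cylinder n B `*` V) = m2 (cylinder n B `*` V)) ->
  forall U, measurable U -> m1 U = m2 U.
Proof.
move=> m12.
have fin_lty (m : subprobability (X * Y)%type R) A : measurable A -> (m A < +oo)%E.
  move=> mA; rewrite (@le_lt_trans _ _ 1%E) ?ltry//.
  by rewrite (le_trans _ (@sprobability_setT _ _ _ m))// le_measure ?inE.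
have rect A V : measurable A -> measurable V -> m1 (A `*` V) = m2 (A `*` V).
  move=> mA mV.
  have mTV : measurable ([set: X] `*` V) by exact: measurableX.
  have E (m : subprobability (X * Y)%type R) B :
      pushforward (mrestr m mTV) fst B = m (B `*` V).
    rewrite /pushforward /mrestr; congr (m _).
    by apply/seteqP; split => z /=; tauto.
  rewrite -!E; apply: (@measure_unique _ _ X cylinders (fun=> setT)) => //.
  - exact: measurable_cylinders.
  - exact: setI_closed_cylinders.
  - by move=> _; exact: cylinders_setT.
  - by rewrite bigcup_const.
  - by move=> _ [n [B [mB ->]]]; rewrite /= !E; exact: m12.
  - by move=> _; rewrite /= E; exact: fin_lty.
apply: (@measure_unique _ _ _ [set A `*` B | A in measurable & B in measurable]
  (fun=> setT)).
- exact: measurable_prod_measurableType.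
- move=> _ _ [A mA [V mV <-]] [A' mA' [V' mV' <-]]; rewrite -setXI.
  exists (A `&` A'); first exact: measurableI.
  by exists (V `&` V') => //; exact: measurableI.
- by move=> _; exists setT => //; exists setT => //; rewrite setXTT.
- by rewrite bigcup_const.
- by move=> _ [A mA [V mV <-]]; exact: rect.
- by move=> _; exact: fin_lty.
Qed.

End cylinders.

(** Convergence is the Cauchy property, a countable condition. *)
Lemma measurable_set_cvg d (T : measurableType d) (R : realType)
    (f : nat -> T -> R) :
  (forall n, measurable_fun setT (f n)) ->
  measurable [set x | cvgn (f ^~ x)].
Proof.
move=> mf.
rewrite (_ : [set _ | _] = \bigcap_m \bigcup_N \bigcap_i
    [set x | `|f N x - f (N + i)%N x| <= m.+1%:R^-1]).
  apply: bigcapT_measurable => m; apply: bigcupT_measurable => N.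
  apply: bigcapT_measurable => i.
  have mg : measurable_fun setT (fun x => `|f N x - f (N + i)%N x|).
    by apply: measurableT_comp => //; exact: measurable_funB.
  rewrite (_ : [set _ | _] = setT `&` (fun x => `|f N x - f (N + i)%N x|) @^-1`
    [set` `]-oo, m.+1%:R^-1]]); first exact: mg.
  by rewrite setTI; apply/seteqP; split => x; rewrite /= in_itv.
apply/seteqP; split => x /=.
  move=> /cvg_ex[/= l fl] m _.
  have m0 : 0 < m.+1%:R^-1 / 2 :> R by rewrite divr_gt0// invr_gt0.
  have /cvgrPdist_le /(_ _ m0) [N _ fN] := fl.
  exists N => // i _ /=; rewrite [leRHS]splitr -(subrK l (f N x)) -addrA.
  rewrite (le_trans (ler_normD _ _))// lerD//; last exact/fN/leq_addr.
  by rewrite distrC; exact: (fN N (leqnn N)).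
move=> fx; apply: cauchy_cvg; apply/cauchy_exP => e e0.
have [m me] : exists m, m.+1%:R^-1 < e.
  by have [m] := ltr_add_invr e0; rewrite add0r; exists m.
have [N _ fN] := fx m I.
exists (f N x), N => // n /= Nn.
by rewrite /ball/= (le_lt_trans _ me)// -(subnKC Nn); exact: fN.
Qed.

Lemma product_measure1_dirac d1 d2 (T1 : measurableType d1)
    (T2 : measurableType d2) (R : realType) (a : T1)
    (m : {sigma_finite_measure set T2 -> \bar R}) (U : set (T1 * T2)) :
  measurable U ->
  ((dirac a : {sigma_finite_measure set T1 -> \bar R}) \x m)%E U =
  m (xsection U a).
Proof.
move=> mU; rewrite /product_measure1 integral_dirac//.
  by rewrite diracT mul1e.
exact: measurable_fun_xsection.
Qed.

Lemma subprobability_carried d (T : measurableType d) (R : realType)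
    (mu : subprobability T R)
    (C : set T) : measurable C -> mu C = 1%E -> mu (~` C) = 0%E.
Proof.
move=> mC muC.
have : (mu C + mu (~` C) <= 1)%E.
  rewrite -measureU//; last exact: setICr; last exact: measurableC.
  by rewrite setUCr sprobability_setT.
rewrite muC -leeBrDl// subee// => muC0.
by apply/eqP; rewrite eq_le muC0 measure_ge0.
Qed.

Lemma subprobability_carriedI d (T : measurableType d) (R : realType)
    (mu : subprobability T R)
    (C U : set T) : measurable C -> measurable U -> mu C = 1%E ->
  mu (U `&` C) = mu U.
Proof.
move=> mC mU muC; have UC0 : mu (U `\` C) = 0%E.
  apply/eqP; rewrite eq_le measure_ge0 andbT -[leRHS](subprobability_carried mC muC).
  apply: le_measure; rewrite ?inE; [exact: measurableD|exact: measurableC|].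
  by move=> x [].
by rewrite [RHS](measureDI mu mU mC) [X in (X + _)%E]UC0 add0e.
Qed.

(** * Independent sequences with a given finite law *)

(** The rescaled image of Lebesgue measure agrees with it on intervals, hence
    everywhere. *)
Lemma lebesgue_measure_affine (R : realType) (a b : R) (C : set R) :
  0 < a -> measurable C ->
  lebesgue_measure [set u | C ((u - b) / a)] = (a%:E * lebesgue_measure C)%E.
Proof.
move=> a0 mC.
pose phi (u : measurableTypeR R) : measurableTypeR R := (u - b) / a.
have mphi : measurable_fun setT phi.
  have : measurable_fun setT (phi : R -> R).
    by apply: measurable_funM => //; exact: measurable_funB.
  exact.
have ai0 : 0 <= a^-1 by rewrite invr_ge0 ltW.
have muE A : measurable A ->
    lebesgue_measure A = mscale (NngNum ai0) (pushforward lebesgue_measure phi) A.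
  apply: lebesgue_measure_unique => _ [[x y] _ <-].
  transitivity ((a^-1)%:E * lebesgue_measure
    (`](a * x + b)%R, (a * y + b)%R]%classic : set R))%E; last first.
    congr (_ * lebesgue_measure _)%E.
    apply/seteqP; split => u;
      rewrite /= !in_itv/= /phi ltr_pdivlMr// ler_pdivrMr//;
      by rewrite ltrBrDr lerBlDr ![_ * a]mulrC.
  rewrite !lebesgue_measure_itv/= !lte_fin ltrD2r ltr_pM2l//.
  case: ifPn => _; last by rewrite mule0.
  by rewrite -!EFinB -EFinM; congr EFin; field; rewrite gt_eqF.
by rewrite (muE mphi C)// /mscale/= muleA -EFinM mulfV ?gt_eqF// mul1e.
Qed.

Section iid_sequences.
Context d d' (Omega : measurableType d) (T : measurableType d') (R : realType).
Local Open Scope ereal_scope.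

(** If [shift] is independent of [out] and preserves [P], then the outputs
    read off along the orbit of a point are independent with law [q]. *)
Lemma iid_of_shift (P : probability Omega R) (out : Omega -> T)
    (shift : Omega -> Omega) (q : set T -> \bar R) :
  measurable_fun setT out -> measurable_fun setT shift ->
  (forall B C, measurable B -> measurable C ->
    P (out @^-1` B `&` shift @^-1` C) = q B * P C) ->
  forall n (B : nat -> set T), (forall i, measurable (B i)) ->
    P [set u | forall i, (i < n)%N -> B i (out (iter i shift u))] =
    \prod_(i < n) q (B i).
Proof.
move=> mout mshift Pq; elim=> [|n IHn] B mB.
  by rewrite big_ord0 -(probability_setT P); congr (P _); apply/seteqP; split.
have miter i : measurable_fun setT (iter i shift).
  by elim: i => [|i IHi]; [exact: measurable_id|exact: measurableT_comp].
pose C := [set u | forall i, (i < n)%N -> B i.+1 (out (iter i shift u))].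
have mC : measurable C.
  rewrite (_ : C = \bigcap_(i in `I_n) ((out \o iter i shift) @^-1` B i.+1)).
    apply: fin_bigcap_measurable => // i _; rewrite -[X in measurable X]setTI.
    by apply: (measurableT_comp mout (miter i)).
  by apply/seteqP; split.
rewrite big_ord_recl/= -(IHn (fun i => B i.+1))// -Pq//.
congr (P _); apply/seteqP; split => u /=.
  move=> Bu; split => [|i ni]; first exact: (Bu 0%N).
  by rewrite -iterSr; exact: (Bu i.+1).
by move=> [B0 Bu] [_ //|i ni]; rewrite iterSr; exact: Bu.
Qed.

End iid_sequences.

Section digits.
Context d (T : measurableType d) (R : realType).

(** An interval starting at [c] is cut into consecutive intervals of lengths
    [w k], one for each letter [k] of [r]. The result is the letter of the interval
    that contains [u], with the position of [u] in it rescaled to [ ]0, 1] ]; the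
    letter [k0] only keeps the function total. *)
Fixpoint digit (w : T -> R) (k0 : T) (r : seq T) (c u : R) : T * R :=
  if r is k :: r' then
    if (u <= c + w k)%R then (k, ((u - c) / w k)%R) else
      digit w k0 r' (c + w k)%R u
  else (k0, u).

Lemma digit_mem w k0 r c u : (digit w k0 r c u).1 \in k0 :: r.
Proof.
elim: r c => [|k r IHr] c /=; first by rewrite mem_head.
case: ifP => _ /=; first by rewrite !inE eqxx orbT.
by move: (IHr (c + w k)%R); rewrite !inE => /orP[->//|->]; rewrite !orbT.
Qed.

Lemma measurable_digit w k0 r c : measurable_fun setT (digit w k0 r c).
Proof.
elim: r c => [|k r IHr] c /=.
  exact: measurable_fun_pair.
apply: measurable_fun_if => //.
- exact: measurable_fun_ler.
- apply: (@measurable_funS _ _ _ _ setT) => //.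
  apply: measurable_fun_pair => //.
  by apply: measurable_funM => //; exact: measurable_funB.
- exact: (@measurable_funS _ _ _ _ setT).
Qed.

(** Letter and rescaled position are independent: the interval of [k] is a copy
    of [ ]0, 1] ] scaled by [w k], so it contributes [w k] times the measure of
    the part of [C] in [ ]0, 1] ] if [k] is in [B]. *)
Lemma lebesgue_digit (w : T -> R) (k0 : T) (r : seq T) (c : R)
    (B : set T) (C : set R) :
  (forall k, 0 <= w k) -> measurable B -> measurable C ->
  lebesgue_measure
    (`]c, (c + \sum_(k <- r) w k)] `&`
     digit w k0 r c @^-1` (B `*` C)) =
  ((\sum_(k <- r) w k * \1_B k)%:E * lebesgue_measure (C `&` `]0%R, 1%R]))%E.
Proof.
move=> w0 mB mC; elim: r c => [|k r IHr] c.
  by rewrite !big_nil addr0 mul0e set_itvoc0 set0I measure0.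
rewrite !big_cons EFinD ge0_muleDl ?lee_fin ?mulr_ge0 ?sumr_ge0//; last first.
  by move=> i _; rewrite mulr_ge0.
rewrite -(IHr (c + w k)) addrA.
have sumw0 : 0 <= \sum_(k <- r) w k by apply: sumr_ge0.
pose D := `]c, c + w k] `&` [set u | B k /\ C ((u - c) / w k)].
have [mD lD] : measurable D /\
    lebesgue_measure D =
    ((w k * \1_B k)%:E * lebesgue_measure (C `&` `]0%R, 1%R]))%E.
  have [Bk|nBk] := pselect (B k); last first.
    rewrite (_ : D = set0); first by rewrite measure0 indicE memNset// mulr0 mul0e.
    by rewrite -subset0 => u [_ []].
  have [wk0|wk0] := eqVneq (w k) 0.
    rewrite (_ : D = set0); first by rewrite measure0 wk0 mul0r mul0e.
    by rewrite /D wk0 addr0 set_itvoc0 set0I.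
  have wk_gt0 : 0 < w k by rewrite lt_neqAle eq_sym wk0 w0.
  have mC01 : measurable (C `&` `]0, 1]) by exact: measurableI.
  have -> : D = [set u | (C `&` `]0, 1]) ((u - c) / w k)].
    apply/seteqP; split => u /=; rewrite !in_itv/= ltr_pdivlMr// ler_pdivrMr//;
      rewrite mul0r mul1r subr_gt0 lerBlDl.
      by move=> [cu [_ Cu]].
    by move=> [Cu cu].
  rewrite indicE mem_set// mulr1; split; last exact: lebesgue_measure_affine.
  have : measurable_fun setT (fun u : R => (u - c) / w k).
    by apply: measurable_funM => //; exact: measurable_funB.
  by move=> /(_ measurableT _ mC01); rewrite setTI.
rewrite -lD -measureU//.
- rewrite /D; congr (lebesgue_measure _); apply/seteqP; split => u /=.
  + rewrite !in_itv/= => -[/andP[cu uS]]; case: ifPn => [ucw|]/=.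
      by move=> [Bk Cu]; left; rewrite cu.
    by rewrite -ltNge => ucw BC; right; rewrite ucw uS.
  + rewrite !in_itv/= => -[[]|[]].
      move=> /andP[cu ucw] [Bk Cu]; rewrite cu ucw/= (le_trans ucw)//.
      by rewrite lerDl.
    move=> /andP[ucw uS] BC; rewrite uS (le_lt_trans _ ucw) ?lerDl//=.
    by rewrite leNgt ucw.
- apply: measurableI => //; rewrite -[X in measurable X]setTI.
  by apply: measurable_digit => //; exact: measurableX.
- rewrite -subset0 => u [[/= + _] [/= + _]]; rewrite !in_itv/=.
  by move=> /andP[_ ucw] /andP[]; rewrite ltNge ucw.
Qed.

End digits.

Section iid_existence.
Context d (T : measurableType d) (R : realType).

Definition unit_lebesgue : set (measurableTypeR R) -> \bar R :=
  mrestr lebesgue_measure (measurable_itv `]0%R, 1%R]).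

HB.instance Definition _ := Measure.on unit_lebesgue.

Let unit_lebesgueT : unit_lebesgue setT = 1%E.
Proof.
rewrite /unit_lebesgue /mrestr setTI lebesgue_measure_itv/=.
by rewrite lte_fin ltr01 oppr0 adde0.
Qed.

HB.instance Definition _ :=
  Measure_isProbability.Build _ _ _ unit_lebesgue unit_lebesgueT.

Lemma exists_iid_sequence (w : T -> R) (k0 : T) (r : seq T) :
  (forall k, 0 <= w k) -> \sum_(k <- r) w k = 1 ->
  exists2 nu : probability (seq_measurableType T) R,
    forall n (B : nat -> set T), (forall i, measurable (B i)) ->
      nu (cylinder n B) =
      (\prod_(i < n) (\sum_(k <- r) w k * \1_(B i) k)%:E)%E
  & nu [set x | forall i, x i \in k0 :: r] = 1%E.
Proof.
move=> w0 w1.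
pose out (u : measurableTypeR R) : T := (digit w k0 r 0 u).1.
pose shift (u : measurableTypeR R) : measurableTypeR R := (digit w k0 r 0 u).2.
have mdigit := measurable_digit w k0 r 0.
have mout : measurable_fun setT out.
  exact: (measurableT_comp measurable_fst mdigit).
have mshift : measurable_fun setT shift.
  exact: (measurableT_comp measurable_snd mdigit).
pose orbit (u : measurableTypeR R) : seq_measurableType T :=
  fun i => out (iter i shift u).
have morbit : measurable_fun setT orbit.
  apply: (@measurability _ _ _ _ setT orbit (@seq_cylinders _ T)) => //.
  move=> _ [_ [i [A [mA ->]] <-]].
  have miter : measurable_fun setT (iter i shift).
    by elim: i => [|i IHi]; [exact: measurable_id|exact: measurableT_comp].
  exact: (measurableT_comp mout miter).
pose orbit' : {mfun measurableTypeR R >-> seq_measurableType T} :=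
  HB.pack orbit (isMeasurableFun.Build _ _ _ _ orbit morbit).
exists (distribution unit_lebesgue orbit').
  move=> n B mB; apply: (iid_of_shift (P := unit_lebesgue)
    (q := fun B => (\sum_(k <- r) w k * \1_B k)%:E) mout mshift _ n mB).
  move=> {}B C {}mB mC; rewrite -[RHS](lebesgue_digit k0 r 0 w0 mB mC) w1 add0r.
  by congr (lebesgue_measure _); exact: setIC.
rewrite -(probability_setT unit_lebesgue); congr (unit_lebesgue _).
by apply/seteqP; split => // u _ i; exact: digit_mem.
Qed.

End iid_existence.

(** * A strong law from second moments *)

Section bounded_functions.
Context d (T : measurableType d) (R : realType) (mu : subprobability T R).
Implicit Types f : T -> R.

Lemma integrable_bounded f (M : R) : measurable_fun setT f ->
  (forall x, `|f x| <= M) -> mu.-integrable setT (EFin \o f).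
Proof.
move=> mf fM; apply: measurable_bounded_integrable => //.
  by rewrite (le_lt_trans (@sprobability_setT _ _ _ mu))// ltry.
exists M; split; first exact: num_real.
by move=> y My x _ /=; rewrite (le_trans (fM x))// ltW.
Qed.

Lemma integrable_Rsum (I : Type) (s : seq I) (f : I -> T -> R) :
  (forall i, mu.-integrable setT (EFin \o f i)) ->
  mu.-integrable setT (EFin \o (fun x => \sum_(i <- s) f i x)).
Proof.
move=> intf.
rewrite (_ : _ \o _ = fun x => (\sum_(i <- s) (EFin \o f i) x)%E).
  exact: integrable_sum.
by apply/funext => x /=; rewrite sumEFin.
Qed.

Lemma Rintegral_sum (I : Type) (s : seq I) (f : I -> T -> R) :
  (forall i, mu.-integrable setT (EFin \o f i)) ->
  \int[mu]_x (\sum_(i <- s) f i x) = \sum_(i <- s) \int[mu]_x f i x.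
Proof.
move=> intf; elim: s => [|i s IHs].
  under eq_Rintegral do rewrite big_nil.
  by rewrite Rintegral_cst// mul0r big_nil.
under eq_Rintegral do rewrite big_cons.
by rewrite RintegralD// ?big_cons ?IHs//; exact: integrable_Rsum.
Qed.

End bounded_functions.

Section second_moments.
Context d (T : measurableType d) (R : realType) (mu : subprobability T R).
Variables (xi : nat -> T -> R) (p c : R).
Hypothesis mxi : forall i, measurable_fun setT (xi i).
Hypothesis xi01 : forall i x, 0 <= xi i x <= 1.
Hypothesis moment : forall i j,
  \int[mu]_x (xi i x * xi j x) = if i == j then p else c.

Let xi_norm i x : `|xi i x| <= 1.
Proof. by rewrite ger0_norm; case/andP: (xi01 i x). Qed.

Let integrable_xiM i j : mu.-integrable setT (EFin \o (fun x => xi i x * xi j x)).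
Proof.
apply: (@integrable_bounded _ _ _ _ _ 1) => [|x]; first exact: measurable_funM.
by rewrite normrM mulr_ile1.
Qed.

Let integrable_cxiM (a : R) i j :
  mu.-integrable setT (EFin \o (fun x => a * (xi i x * xi j x))).
Proof. exact: (integrableZl measurableT a (integrable_xiM i j)). Qed.

(** The matrix of second moments is [c] times the all-ones matrix plus [p - c]
    times the identity. *)
Lemma second_moment_sum (b : nat -> R) m :
  \int[mu]_x (\sum_(i < m) b i * xi i x) ^+ 2 =
  c * (\sum_(i < m) b i) ^+ 2 + (p - c) * \sum_(i < m) b i ^+ 2.
Proof.
under eq_Rintegral do rewrite expr2 big_distrlr/=.
transitivity (\sum_(i < m) \sum_(j < m) b i * b j * (if i == j then p else c)).
  under eq_Rintegral do
    (under eq_bigr do (under eq_bigr do rewrite mulrACA)).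
  rewrite Rintegral_sum => [|i]; last exact: integrable_Rsum.
  apply: eq_bigr => i _; rewrite Rintegral_sum => [|j]; last by [].
  by apply: eq_bigr => j _; rewrite RintegralZl// moment.
rewrite expr2 big_distrlr/= !big_distrr/= -big_split/=.
apply: eq_bigr => i _; rewrite big_distrr/= (bigD1 i)//= eqxx.
rewrite [X in _ = X + _](bigD1 i)//= addrAC.
congr (_ + _); first by rewrite expr2; ring.
by apply: eq_bigr => j ji; rewrite eq_sym (negbTE ji) mulrC.
Qed.

(** A difference of means is a linear combination with coefficients of sum [0],
    so that the term in [c] of [second_moment_sum] vanishes. *)
Lemma mean_second_moment n m : (0 < n <= m)%N ->
  \int[mu]_x (mean (xi ^~ x) m - mean (xi ^~ x) n) ^+ 2 =
  (p - c) * (n%:R^-1 - m%:R^-1).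
Proof.
move=> /andP[n0 nm]; have m0 : (0 < m)%N by rewrite (leq_trans n0).
pose e i : R := if (i < n)%N then 1 else 0.
pose b i := m%:R^-1 - n%:R^-1 * e i.
have sume (f : nat -> R) : \sum_(i < m) e i * f i = \sum_(i < n) f i.
  rewrite [RHS](big_ord_widen m)// [RHS]big_mkcond/=; apply: eq_bigr => i _.
  by rewrite /e; case: ifP; rewrite ?mul1r ?mul0r.
have sume1 : \sum_(i < m) e i = n%:R.
  have := sume (fun=> 1); under eq_bigr do rewrite mulr1.
  by rewrite sumr_const card_ord.
have nR : n%:R != 0 :> R by rewrite pnatr_eq0 -lt0n.
have mR : m%:R != 0 :> R by rewrite pnatr_eq0 -lt0n.
have sumb : \sum_(i < m) b i = 0.
  rewrite big_split/= sumr_const card_ord sumrN -big_distrr/= sume1.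
  by rewrite mulVf// -[X in X - _]mulr_natl mulfV// subrr.
have sumb2 : \sum_(i < m) b i ^+ 2 = n%:R^-1 - m%:R^-1.
  transitivity (\sum_(i < m)
    (m%:R^-1 ^+ 2 + (n%:R^-1 ^+ 2 - 2 * m%:R^-1 * n%:R^-1) * e i)).
    by apply: eq_bigr => i _; rewrite /b /e; case: ifP => _; ring.
  rewrite big_split/= sumr_const card_ord -big_distrr/= sume1 -[X in X + _]mulr_natl.
  by field; rewrite nR mR.
transitivity (\int[mu]_x (\sum_(i < m) b i * xi i x) ^+ 2); last first.
  by rewrite second_moment_sum sumb sumb2 expr0n mulr0 add0r.
apply: eq_Rintegral => x _; congr (_ ^+ 2).
rewrite /mean -(sume (xi ^~ x)) !big_distrr/= -sumrB.
by apply: eq_bigr => i _; rewrite /b mulrBl mulrA.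
Qed.

(** The constant [5] is large enough for the numerator of the difference to have
    only nonnegative terms. *)
Let cube_step (x : R) : 1 <= x ->
  x ^+ 2 * ((x ^+ 3)^-1 - ((x + 1) ^+ 3)^-1) + x ^- 2 <=
  5 * (x^-1 - (x + 1)^-1).
Proof.
move=> x1; have x0 : 0 < x by rewrite (lt_le_trans ltr01).
have xS0 : 0 < x + 1 by rewrite addr_gt0.
rewrite -subr_ge0 [leRHS](_ : _ =
  (x ^+ 3 + 4 * x ^+ 2 + (x - 1)) / (x ^+ 2 * (x + 1) ^+ 3)).
  have [x0' xS0'] := (ltW x0, ltW xS0).
  apply: divr_ge0; last by rewrite mulr_ge0 ?exprn_ge0.
  have x3 := exprn_ge0 3 x0'; have x2 := exprn_ge0 2 x0'; lra.
by field; rewrite !gt_eqF.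
Qed.

Let jump k x := `|mean (xi ^~ x) (k.+2 ^ 3) - mean (xi ^~ x) (k.+1 ^ 3)|.

Let jump_ge0 k x : 0 <= jump k x. Proof. exact: normr_ge0. Qed.

Let measurable_mean n : measurable_fun setT (fun x => mean (xi ^~ x) n).
Proof. by apply: measurable_funM => //; exact: measurable_sum. Qed.

Let measurable_jump k : measurable_fun setT (jump k).
Proof.
by apply: measurableT_comp => //; exact: measurable_funB.
Qed.

Let jump_le1 k x : `|jump k x| <= 1.
Proof.
rewrite /jump normr_id ler_norml.
have /andP[] := @mean_itv01 _ (xi ^~ x) (k.+2 ^ 3) (xi01 ^~ x).
have /andP[] := @mean_itv01 _ (xi ^~ x) (k.+1 ^ 3) (xi01 ^~ x).
by move=> *; apply/andP; split; lra.
Qed.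

Let integrable_jump k : mu.-integrable setT (EFin \o jump k).
Proof. exact: integrable_bounded. Qed.

(** From [s <= (x s)^2 + 1 / x^2], with [x = k + 1], the first moment of the jump
    [s] is bounded by its second moment; the weight [x^2] makes both terms of
    order [1 / x^2]. *)
Let integral_jump k :
  \int[mu]_x jump k x <= 5 * (k.+1%:R^-1 - k.+2%:R^-1).
Proof.
pose x : R := k.+1%:R.
have x1 : 1 <= x by rewrite ler1n.
have x0 : 0 < x by rewrite ltr0n.
have int2 : mu.-integrable setT (EFin \o (fun t => jump k t ^+ 2)).
  apply: (@integrable_bounded _ _ _ _ _ 1) => [|t].
    by apply: measurable_funX.
  by rewrite normrX exprn_ile1.
have -> : k.+2%:R = x + 1 by rewrite -natr1.
rewrite (le_trans _ (cube_step x1))//.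
rewrite (le_trans (y := \int[mu]_t (x ^+ 2 * jump k t ^+ 2 + x ^- 2)))//.
  apply: le_Rintegral => //.
    apply: (integrableD measurableT (f := fun t => (x ^+ 2 * jump k t ^+ 2)%:E)
      (g := fun=> (x ^- 2)%:E)).
      exact: (integrableZl measurableT (x ^+ 2) int2).
    by apply: finite_measure_integrable_cst.
  move=> t _; have := jump_ge0 k t; move: (jump k t) => s s0.
  rewrite -subr_ge0 (_ : _ - _ = (x * s - x^-1) ^+ 2 + s).
    by rewrite addr_ge0// sqr_ge0.
  by field; rewrite gt_eqF.
rewrite RintegralD//; last 2 first.
- exact: (integrableZl measurableT (x ^+ 2) int2).
- by apply: finite_measure_integrable_cst.
rewrite RintegralZl// Rintegral_cst//.
have mu1 : fine (mu setT) <= 1.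
  by rewrite -lee_fin fineK ?sprobability_setT// fin_num_measure.
have x2 : 0 <= x ^+ 2 by rewrite sqr_ge0.
have x2V : 0 <= x ^- 2 by rewrite invr_ge0.
rewrite lerD// ?ler_piMr// ler_wpM2l//.
have jump2 t : jump k t ^+ 2 =
    (mean (xi ^~ t) (k.+2 ^ 3) - mean (xi ^~ t) (k.+1 ^ 3)) ^+ 2.
  by rewrite real_normK// num_real.
under eq_Rintegral do rewrite jump2.
rewrite mean_second_moment; last by rewrite expn_gt0 leq_exp2r// leqnSn.
rewrite !natrX -[k.+2%:R]natr1 -/x ler_piMl//.
  rewrite subr_ge0 lef_pV2 ?posrE ?exprn_gt0 ?addr_gt0//.
  by rewrite lerXn2r ?nnegrE ?addr_ge0 ?lerDl// ltW.
have c0 : 0 <= c.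
  have /= <- := moment 0%N 1%N; apply: Rintegral_ge0 => t _.
  by case/andP: (xi01 0 t) => ? _; case/andP: (xi01 1 t) => ? _; exact: mulr_ge0.
have p1 : p <= 1.
  rewrite (le_trans _ mu1)//; have /= <- := moment 0%N 0%N; rewrite -[leRHS]mul1r.
  rewrite -Rintegral_cst//; apply: le_Rintegral => //.
    exact: finite_measure_integrable_cst.
  by move=> t _; case/andP: (xi01 0 t) => ? ?; exact: mulr_ile1.
by rewrite lerBlDr (le_trans p1)// lerDl.
Qed.

(** Strong law of large numbers for variables whose mixed second moments are all
    equal: the jumps of the means between consecutive cubes have a finite expected
    sum, so they are almost surely summable. *)
Lemma ae_cvg_mean : {ae mu, forall x, cvgn (mean (xi ^~ x))}.
Proof.
have sum_jump : (\sum_(k <oo) \int[mu]_x (jump k x)%:E <= 5%:E)%E.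
  apply: lime_le.
    by apply: is_cvg_nneseries => k _ _; apply: integral_ge0 => x _; rewrite lee_fin.
  apply: nearW => n.
  rewrite (eq_bigr (fun k => (\int[mu]_x jump k x)%:E)) => [|k _]; last first.
    rewrite /Rintegral fineK//.
    exact: (integrable_fin_num measurableT (integrable_jump k)).
  rewrite sumEFin lee_fin (le_trans (ler_sum _ (fun k _ => integral_jump k)))//.
  rewrite -big_distrr/= -[leRHS]mulr1 ler_pM2l//.
  rewrite (@telescope_sumr_eq _ 0 n (fun k => - k.+1%:R^-1))//; last first.
    by move=> k _; rewrite opprK addrC.
  by rewrite opprK invr1 addrC lerBlDr lerDl.
have : mu.-integrable setT (fun x => \sum_(k <oo) (jump k x)%:E)%E.
  apply/integrableP; split.
    apply: ge0_emeasurable_sum => [k x _ _|k _]; first by rewrite lee_fin.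
    exact/measurable_EFinP.
  have sum_ge0 x : (0 <= \sum_(k <oo) (jump k x)%:E)%E.
    by apply: nneseries_ge0 => k _ _; rewrite lee_fin.
  under eq_integral do rewrite gee0_abs//.
  rewrite integral_nneseries//; last 2 first.
  - by move=> k; exact/measurable_EFinP.
  - by move=> k x _; rewrite lee_fin.
  by rewrite (le_lt_trans sum_jump)// ltry.
move=> /(integrable_ae measurableT); apply: filterS => x /(_ I) jumpx.
apply: cvg_mean_cubes => //.
pose v k := mean (xi ^~ x) (k.+1 ^ 3).
have : cvgn (series (telescope v)).
  apply: normed_cvg; apply: nondecreasing_is_cvgn.
    by apply: nondecreasing_series => *; exact: normr_ge0.
  exists (fine (\sum_(k <oo) (jump k x)%:E)%E) => _ [n _ <-].
  rewrite -lee_fin fineK// /series/= -sumEFin.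
  by apply: nneseries_lim_ge => k _; rewrite lee_fin.
rewrite telescopeK => /cvg_ex[/= l vl]; apply/cvg_ex; exists (l + v 0%N).
have -> : (fun k => mean (xi ^~ x) (k.+1 ^ 3)) = (fun k => (v k - v 0%N) + v 0%N).
  by apply/funext => k; rewrite subrK.
exact: (cvgD vl (cvg_cst (v 0%N))).
Qed.

End second_moments.

(** * Exchangeable laws *)

Section mean_limit.
Context d (T : measurableType d) (R : realType) (mu : subprobability T R).
Variables (H e : T -> R) (xi : nat -> T -> R) (k : nat).

(** Averaging the last hypothesis over all [j] replaces [xi j] by the mean of the
    [xi j], which converges boundedly to [e]; the finitely many [j < k] do not
    affect the limit. *)
Lemma Rintegral_mean_limit :
  measurable_fun setT H -> measurable_fun setT e ->
  (forall i, measurable_fun setT (xi i)) ->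
  (forall x, `|H x| <= 1) -> (forall i x, 0 <= xi i x <= 1) ->
  {ae mu, forall x, mean (xi ^~ x) @ \oo --> e x} ->
  (forall j, (k <= j)%N ->
    \int[mu]_x (H x * xi j x) = \int[mu]_x (H x * xi k x)) ->
  \int[mu]_x (H x * e x) = \int[mu]_x (H x * xi k x).
Proof.
move=> mH me mxi H1 xi01 xie Hxi.
have intHxi j : mu.-integrable setT (EFin \o (fun x => H x * xi j x)).
  apply: (@integrable_bounded _ _ _ _ _ 1) => [|x]; first exact: measurable_funM.
  by rewrite normrM mulr_ile1// ger0_norm; case/andP: (xi01 j x).
have mmean n : measurable_fun setT (fun x => mean (xi ^~ x) n).
  by apply: measurable_funM => //; exact: measurable_sum.
have [|||||intHe _ dct] := @dominated_convergence _ _ _ mu setT measurableT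
  (fun n x => (H x * mean (xi ^~ x) n)%:E) (fun x => (H x * e x)%:E) (fun=> 1%E).
- by move=> n; apply/measurable_EFinP; exact: measurable_funM.
- by apply/measurable_EFinP; exact: measurable_funM.
- apply: filterS xie => x xe _; apply: cvg_EFin; first exact: nearW.
  exact: cvgMl_tmp.
- exact: finite_measure_integrable_cst.
- apply: aeW => x n _; rewrite lee_fin normrM mulr_ile1//.
  by rewrite ger0_norm; have /andP[] := @mean_itv01 _ (xi ^~ x) n (xi01 ^~ x).
have {}dct : \int[mu]_x (H x * mean (xi ^~ x) n) @[n --> \oo] -->
    \int[mu]_x (H x * e x).
  by apply: fine_cvg; rewrite fineK// integrable_fin_num.
have meanE n : \int[mu]_x (H x * mean (xi ^~ x) n) =
    mean (fun j => \int[mu]_x (H x * xi j x)) n.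
  rewrite /mean -Rintegral_sum// -RintegralZl//; last exact: integrable_Rsum.
  by apply: eq_Rintegral => x _; rewrite mulrCA big_distrr.
have cesa : mean (fun j => \int[mu]_x (H x * xi j x)) n @[n --> \oo] -->
    \int[mu]_x (H x * xi k x).
  have : \int[mu]_x (H x * xi j x) @[j --> \oo] --> \int[mu]_x (H x * xi k x).
    by apply: cvg_near_cst; exists k.
  move=> /cesaro; rewrite /arithmetic_mean /series /= => cs.
  rewrite -cvg_shiftS; apply: cvg_trans cs; apply: near_eq_cvg.
  by apply: nearW => n; rewrite /mean/= big_mkord.
rewrite (funext meanE) in dct.
exact: (cvg_unique _ dct cesa).
Qed.

End mean_limit.

Definition swap (a b i : nat) := if i == a then b else if i == b then a else i.

Lemma swapL a b : swap a b a = b.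
Proof. by rewrite /swap eqxx. Qed.

Lemma swapK a b : involutive (swap a b).
Proof.
move=> i; have [->|ia] := eqVneq i a.
  by rewrite swapL /swap; case: eqVneq => [//|_]; rewrite eqxx.
rewrite {2}/swap (negbTE ia); have [->|ib] := eqVneq i b; first exact: swapL.
by rewrite /swap (negbTE ia) (negbTE ib).
Qed.

Lemma swap_out a b i : i != a -> i != b -> swap a b i = i.
Proof. by rewrite /swap => /negbTE-> /negbTE->. Qed.

Lemma finite_perm_swap a b : finite_perm (swap a b).
Proof.
split.
  by exists (swap a b); exact: swapK.
apply: (@sub_finite_set _ _ [set a; b]); last exact: finite_set2.
move=> i /=; rewrite /swap; case: (eqVneq i a) => [->|_]; first by left.
by case: (eqVneq i b) => [->|_]; [right|rewrite eqxx].
Qed.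

Section exchangeable_laws.
Context d d' (T : measurableType d) (Y : measurableType d') (R : realType).
Local Notation X := (seq_measurableType T).
Variable mu : subprobability (X * Y)%type R.

Definition reindex_fst (s : nat -> nat) (z : X * Y) : X * Y := (z.1 \o s, z.2).

Lemma measurable_reindex_fst s : measurable_fun setT (reindex_fst s).
Proof.
apply: measurable_fun_pair => //.
apply: (@measurability _ _ _ _ setT (fun z : X * Y => z.1 \o s : X)
  (@seq_cylinders _ T)) => //.
move=> _ [_ [i [A [mA ->]] <-]].
exact: (measurableT_comp (measurable_coord (s i)) measurable_fst).
Qed.

Hypothesis mu_exch : forall s, finite_perm s -> forall U, measurable U ->
  mu (reindex_fst s @^-1` U) = mu U.

Lemma Rintegral_reindex s (g : X * Y -> R) : finite_perm s ->
  measurable_fun setT g -> (forall z, 0 <= g z) ->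
  \int[mu]_z g (reindex_fst s z) = \int[mu]_z g z.
Proof.
move=> fs mg g0; rewrite /Rintegral; congr fine.
have ms := measurable_reindex_fst s.
transitivity (\int[pushforward mu (reindex_fst s)]_z (g z)%:E)%E.
  rewrite ge0_integral_pushforward//.
  - exact/measurable_EFinP.
  - by move=> z _; rewrite lee_fin.
by apply: eq_measure_integral => A mA _; exact: mu_exch.
Qed.

(** Two transpositions carry any two distinct positions to [0] and [1]. *)
Lemma ae_cvg_frequency (B : set T) : measurable B ->
  {ae mu, forall z, cvgn (frequency R B z.1)}.
Proof.
move=> mB; pose xi i (z : X * Y) : R := \1_B (z.1 i).
have mxi i : measurable_fun setT (xi i).
  apply: (measurableT_comp (f := \1_B : T -> R)); first exact: measurable_indic.
  exact: (measurableT_comp (measurable_coord i) measurable_fst).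
have xi01 i z : 0 <= xi i z <= 1.
  exact: indic_itv01.
have xi0 i z : 0 <= xi i z by case/andP: (xi01 i z).
have moment i j : \int[mu]_z (xi i z * xi j z) =
    if i == j then \int[mu]_z (xi 0 z * xi 0 z) else \int[mu]_z (xi 0 z * xi 1 z).
  have mM a b : measurable_fun setT (fun z => xi a z * xi b z).
    exact: measurable_funM.
  have M0 a b z : 0 <= xi a z * xi b z by exact: mulr_ge0.
  have [<-|ij] := eqVneq i j.
    by rewrite -(Rintegral_reindex (finite_perm_swap 0 i) (mM 0%N 0%N)
      (M0 0%N 0%N)).
  pose j' := swap 0 i j.
  transitivity (\int[mu]_z (xi 0 z * xi j' z)).
    rewrite -[RHS](Rintegral_reindex (finite_perm_swap 0 i) (mM 0%N j')
      (M0 0%N j')).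
    by apply: eq_Rintegral => z _; rewrite /xi /reindex_fst/= swapL swapK.
  rewrite -[RHS](Rintegral_reindex (finite_perm_swap 1 j') (mM 0%N 1%N)
    (M0 0%N 1%N)).
  apply: eq_Rintegral => z _; rewrite /xi /reindex_fst/= swapL swap_out//.
  by apply: contra_neq ij => j0; rewrite -(swapK 0 i j) -/j' -j0 swapL.
have := ae_cvg_mean mxi xi01 moment; apply: filterS => z.
by rewrite frequency_mean.
Qed.

(* The limiting frequencies, completed in an arbitrary invariant way where they
   do not exist. *)
Variable e : set T -> X -> R.
Hypothesis me : forall B, measurable B -> measurable_fun setT (e B).
Hypothesis e01 : forall B x, 0 <= e B x <= 1.
Hypothesis e_inv : forall s B x, finite_perm s -> e B (x \o s) = e B x.
Hypothesis e_lim : forall B, measurable B ->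
  {ae mu, forall z, frequency R B z.1 @ \oo --> e B z.1}.

Let measurable_e B : measurable B -> measurable_fun setT (fun z : X * Y => e B z.1).
Proof. by move=> mB; exact: (measurableT_comp (me mB) measurable_fst). Qed.

(** De Finetti's theorem on rectangles: the indicators of the coordinates are
    traded for limiting frequencies one at a time. *)
Lemma exchangeable_rectangle (B : nat -> set T) (V : set Y) n :
  (forall i, measurable (B i)) -> measurable V ->
  mu (cylinder n B `*` V) =
  (\int[mu]_z (\1_V z.2 * \prod_(i < n) e (B i) z.1))%:E.
Proof.
move=> mB mV.
(* The product with the coordinates from [k] on already traded. *)
pose t k i (z : X * Y) : R := if (i < k)%N then \1_(B i) (z.1 i) else e (B i) z.1.
have mind i j : measurable_fun setT (fun z : X * Y => \1_(B i) (z.1 j) : R).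
  apply: (measurableT_comp (f := \1_(B i) : T -> R)); first exact: measurable_indic.
  exact: (measurableT_comp (measurable_coord j) measurable_fst).
have mt k i : measurable_fun setT (t k i).
  by rewrite /t; case: (i < k)%N => //; exact: measurable_e.
have t01 k i z : 0 <= t k i z <= 1.
  by rewrite /t; case: ifP => _ //; exact: indic_itv01.
have mV2 : measurable_fun setT (fun z : X * Y => \1_V z.2 : R).
  by apply: (measurableT_comp (f := \1_V : Y -> R)); first exact: measurable_indic.
pose G k z : R := \1_V z.2 * \prod_(i < n) t k i z.
have step k : (k < n)%N -> \int[mu]_z G k z = \int[mu]_z G k.+1 z.
  move=> kn; pose H z : R := \1_V z.2 * \prod_(i < n | i != k :> nat) t k i z.
  have GE : G k = fun z => H z * e (B k) z.1.
    apply/funext => z; rewrite /G (bigD1 (Ordinal kn))//= /t ltnn.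
    by rewrite /H mulrA mulrAC.
  have GSE : G k.+1 = fun z => H z * \1_(B k) (z.1 k).
    apply/funext => z; rewrite /G (bigD1 (Ordinal kn))//= /t ltnSn.
    rewrite /H mulrA mulrAC; congr (_ * _ * _); apply: eq_bigr => i ik.
    by rewrite ltnS leq_eqVlt (negbTE ik : (i == k :> nat) = false).
  have H0 z : 0 <= H z <= 1.
    have /andP[V0 V1] := indic_itv01 R V z.2.
    have /andP[p0 p1] : 0 <= \prod_(i < n | i != k :> nat) t k i z <= 1.
      rewrite prodr_ge0 => [|i _]; last by case/andP: (t01 k i z).
      by rewrite prodr_ile1// => i _; exact: t01.
    by rewrite mulr_ge0// mulr_ile1.
  have mH : measurable_fun setT H.
    have -> : H = fun z => \1_V z.2 *
        \prod_(i < n) (if i != k :> nat then t k i z else 1).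
      by apply/funext => z; rewrite /H big_mkcond.
    apply: measurable_funM => //.
    by apply: measurable_prod => i _; case: (i != k :> nat).
  have aeB : {ae mu, forall z,
      mean (fun i => \1_(B k) (z.1 i)) @ \oo --> e (B k) z.1}.
    have aeF : Filter (nbhs (almost_everywhere mu)) by exact: _.
    have := e_lim (mB k); apply: filterS => z.
    by rewrite frequency_mean.
  rewrite GE GSE; apply: (Rintegral_mean_limit (H := H) (e := fun z => e (B k) z.1)
    (xi := fun i (z : X * Y) => \1_(B k) (z.1 i)) (k := k)) => //.
  - exact: measurable_e.
  - by move=> z; rewrite ger0_norm; case/andP: (H0 z).
  - by move=> i z; exact: indic_itv01.
  (* For [i < k <= j] the transposition of [k] and [j] fixes coordinate [i], so
     it leaves [H] invariant. *)
  move=> j kj.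
  rewrite -[RHS](Rintegral_reindex (finite_perm_swap k j)); last 2 first.
  - exact: measurable_funM.
  - by move=> z; rewrite mulr_ge0//; case/andP: (H0 z).
  apply: eq_Rintegral => z _; rewrite /= swapL; congr (_ * _).
  rewrite /H/=; congr (_ * _); apply: eq_bigr => i ik; rewrite /t/=.
  rewrite (e_inv _ z.1 (finite_perm_swap k j)); case: ifPn => // i_lt.
  by rewrite /= swap_out// ltn_eqF// (leq_trans i_lt).
have int_G0 k : (k <= n)%N -> \int[mu]_z G 0 z = \int[mu]_z G k z.
  by elim: k => [//|k IHk] kn; rewrite -step// IHk// ltnW.
transitivity (\int[mu]_z G n z)%:E; last first.
  by rewrite -int_G0//; congr EFin; apply: eq_Rintegral => z _.
rewrite (eq_Rintegral mu (g := fun z => \1_(cylinder n B `*` V) z : R)).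
  have mCV := measurableX (measurable_cylinder n mB) mV.
  by rewrite /Rintegral integral_indic// setIT fineK// fin_num_measure.
move=> z _; rewrite /G (eq_bigr (fun i : 'I_n => \1_(B i) (z.1 i))) ?prod_indic.
  by rewrite !indicE in_setX mulrC; do 2 case: (_ \in _); rewrite ?mulr0 ?mulr1.
by move=> i _; rewrite /t ltn_ord.
Qed.

End exchangeable_laws.

(** * The empirical sampling kernel *)

Section limit_frequencies.
Context (R : realType) (F : mspace).
Variable r : seq F.
Hypothesis r_uniq : uniq r.
Hypothesis rE : carrier F = [set` r].
Hypothesis discF : forall T : set F, T `<=` carrier F -> measurable T.

Definition es_dom : set (ms_seq F) :=
  [set x | carrier (ms_seq F) x /\
     forall T : set F, T `<=` carrier F -> cvgn (frequency R T x)].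

(** Expressed through the letters in order to have the limits of all subsets at
    once; see [cvg_frequency]. *)
Definition limit_frequency (x : nat -> F) (B : set F) : R :=
  \sum_(k <- r) limn (frequency R [set k] x) * \1_B k.

Lemma atom_sub k : k \in r -> [set k] `<=` carrier F.
Proof. by rewrite rE => kr _ ->. Qed.

Lemma cvg_frequency_atoms (x : ms_seq F) : carrier (ms_seq F) x ->
  (forall k, k \in r -> cvgn (frequency R [set k] x)) ->
  forall B, frequency R B x @ \oo --> limit_frequency x B.
Proof.
move=> Fx xk B.
have xr i : x i \in r by have := Fx i; rewrite rE.
rewrite (funext (fun n => frequency_atoms R B n r_uniq xr)).
rewrite /limit_frequency big_seq; under eq_fun do rewrite big_seq.
apply: cvg_big => [|k kr]; first exact: add_continuous.
by apply: cvgMr_tmp; exact: xk.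
Qed.

Lemma es_domP (x : ms_seq F) : es_dom x <->
  carrier (ms_seq F) x /\ forall k, k \in r -> cvgn (frequency R [set k] x).
Proof.
split=> -[Fx xT]; split => //.
  by move=> k kr; apply: xT; exact: atom_sub.
by move=> T _; apply: cvgP; exact: cvg_frequency_atoms.
Qed.

Lemma cvg_frequency x (B : set F) : es_dom x ->
  frequency R B x @ \oo --> limit_frequency x B.
Proof. by move=> /es_domP[Fx xk]; exact: cvg_frequency_atoms. Qed.

Lemma limit_frequency01 x B : es_dom x -> 0 <= limit_frequency x B <= 1.
Proof.
move=> Ex; have xB := @cvg_frequency x B Ex; apply/andP; split.
  rewrite -(cvg_lim _ xB)//; apply: limr_ge; first exact: cvgP xB.
  by apply: nearW => n; exact: frequency_ge0.
rewrite -(cvg_lim _ xB)//; apply: limr_le; first exact: cvgP xB.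
by apply: nearW => n; exact: frequency_le1.
Qed.

Lemma limit_frequency_carrier x : es_dom x -> limit_frequency x (carrier F) = 1.
Proof.
move=> Ex; have xF := @cvg_frequency x (carrier F) Ex.
rewrite -(cvg_lim _ xF)//; apply: cvg_lim => //.
rewrite -cvg_shiftS; apply: cvg_near_cst; apply: nearW => n.
by apply: frequency_full; case: Ex.
Qed.

Lemma measurable_frequency (B : set F) n : measurable B ->
  measurable_fun setT (fun x : ms_seq F => frequency R B x n).
Proof.
move=> mB; under eq_fun do rewrite frequencyE.
apply: measurable_funM => //; apply: measurable_sum => i.
apply: (measurableT_comp (f := \1_B : F -> R)); first exact: measurable_indic.
exact: measurable_coord.
Qed.

Lemma measurable_es_dom : measurable es_dom.
Proof.
rewrite (_ : es_dom = carrier (ms_seq F) `&` \bigcap_(k in [set` r])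
    [set x : ms_seq F | cvgn (frequency R [set k] x)]).
  apply: measurableI; first exact: measurable_carrier.
  apply: fin_bigcap_measurable; first exact: finite_seq.
  move=> k kr; apply: measurable_set_cvg => n.
  by apply: measurable_frequency; apply: discF; exact: atom_sub.
by apply/seteqP; split => x /es_domP.
Qed.

Lemma measurable_limit_frequency (B : set F) : measurable B ->
  measurable_fun es_dom (fun x => limit_frequency x B).
Proof.
move=> mB; apply: (@measurable_fun_cvg _ _ R es_dom (fun n x => frequency R B x n)).
- move=> n; apply: (@measurable_funS _ _ _ _ setT) => //.
  exact: measurable_frequency.
- by move=> x Ex; exact: cvg_frequency.
Qed.

Lemma es_dom_perm s (x : ms_seq F) : finite_perm s -> es_dom (x \o s) <-> es_dom x.
Proof.
move=> fs; have [[s' ss' s's] _] := fs.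
rewrite !es_domP; split=> -[Fx xk]; split.
- by move=> i; rewrite -(s's i); exact: Fx.
- move=> k /xk /cvg_ex[/= l xl]; apply: (cvgP l).
  exact/(frequency_finite_perm_cvg _ _ _ fs).
- by move=> i; exact: Fx.
- move=> k /xk /cvg_ex[/= l xl]; apply: (cvgP l).
  exact/(frequency_finite_perm_cvg _ _ _ fs).
Qed.

Lemma limit_frequency_perm s x B : finite_perm s -> es_dom x ->
  limit_frequency (x \o s) B = limit_frequency x B.
Proof.
move=> fs Ex; have Exs : es_dom (x \o s) by exact/es_dom_perm.
apply: (@cvg_unique _ _ (frequency R B x @ \oo)) => //; last exact: cvg_frequency.
by apply/(frequency_finite_perm_cvg _ _ _ fs); exact: cvg_frequency.
Qed.

Lemma exists_limit_law : exists h : ms_seq F -> probability (seq_measurableType F) R,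
  forall x, es_dom x ->
    (forall n B, (forall i, measurable (B i)) ->
      h x (cylinder n B) = (\prod_(i < n) (limit_frequency x (B i))%:E)%E) /\
    h x (carrier (ms_seq F)) = 1%E.
Proof.
suff : forall x, exists nu : probability (seq_measurableType F) R, es_dom x ->
    (forall n B, (forall i, measurable (B i)) ->
      nu (cylinder n B) = (\prod_(i < n) (limit_frequency x (B i))%:E)%E) /\
    nu (carrier (ms_seq F)) = 1%E.
  by move=> /choice[h hP]; exists h.
move=> x; have [Ex|nEx] := pselect (es_dom x); last first.
  by exists (dirac (point : seq_measurableType F)).
pose w k : R := if k \in r then limn (frequency R [set k] x) else 0.
have w0 k : 0 <= w k.
  rewrite /w; case: ifPn => // kr; apply: limr_ge.
    by have /es_domP[_] := Ex; apply.
  by apply: nearW => n; exact: frequency_ge0.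
have wE B : \sum_(k <- r) w k * \1_B k = limit_frequency x B.
  by apply: eq_big_seq => k kr; rewrite /w kr.
have w1 : \sum_(k <- r) w k = 1.
  rewrite -(limit_frequency_carrier Ex) -wE; apply: eq_big_seq => k kr.
  by rewrite indicE mem_set ?mulr1// rE.
have [nu nuE nu1] := exists_iid_sequence (x 0%N) w0 w1.
exists nu => _; split.
  by move=> n B mB; rewrite nuE//; apply: eq_bigr => i _; rewrite wE.
rewrite -nu1; congr (nu _); apply/seteqP; split => y yr i.
  by rewrite inE; apply/orP; right; have := yr i; rewrite rE.
have := yr i; rewrite inE rE => /orP[/eqP ->|//].
by case: Ex => /(_ 0%N) + _; rewrite rE.
Qed.

End limit_frequencies.

Section exchangeable_kernels.
Context (R : realType) (X Y : mspace).

(** Composing with the kernel of a map pushes each law forward along the map, so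
    exchangeability of a kernel is invariance of its laws. *)
Lemma exchangeable_invariant (A : mspace)
    (f : pkernel R A (ms_prod (ms_seq X) Y)) (a : A) : exchangeable f -> pdom f a ->
  forall s, finite_perm s -> forall U, measurable U ->
    f a (reindex_fst s @^-1` U) = f a U.
Proof.
move=> exf fa s fs U mU.
have [domE kerE] := exf s fs.
have gfa : pdom (Defs.pcomp (ptensor (preindex R X s) (pid R Y)) f) a.
  by rewrite domE.
rewrite -(kerE a gfa U mU) pcomp_kerE/=.
have mC : measurable (seq_carrier X `*` carrier Y).
  exact: (measurable_carrier (ms_prod (ms_seq X) Y)).
have mpre : measurable (reindex_fst s @^-1` U).
  by rewrite -[X in measurable X]setTI; exact: measurable_reindex_fst.
have kerU z : ptensor (preindex R X s) (pid R Y) z U =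
    (\1_(reindex_fst s @^-1` U) z)%:E.
  transitivity (\d_(z.2) (xsection U (z.1 \o s : ms_seq X)) : \bar R)%E.
    exact: product_measure1_dirac.
  by rewrite diracE mem_xsection.
under eq_integral do rewrite kerU.
rewrite integral_indic//.
have fC : f a (seq_carrier X `*` carrier Y) = 1%E := pker_carrier fa.
exact/esym/subprobability_carriedI.
Qed.

End exchangeable_kernels.

Section empirical_sampling_kernel.
Context (R : realType) (F : mspace).
Variable r : seq F.
Hypothesis r_uniq : uniq r.
Hypothesis rE : carrier F = [set` r].
Hypothesis discF : forall T : set F, T `<=` carrier F -> measurable T.
Local Notation D := (@es_dom R F).
Local Notation q := (limit_frequency R r).
(* [h x] is the law of an independent sequence of letters whose law is given by
   the limiting frequencies of [x]. *)
Variable h : ms_seq F -> probability (seq_measurableType F) R.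
Hypothesis h_cyl : forall x, D x -> forall n B, (forall i, measurable (B i)) ->
      h x (cylinder n B) = (\prod_(i < n) (q x (B i))%:E)%E.
Hypothesis h_carrier : forall x, D x -> h x (carrier (ms_seq F)) = 1%E.

Let mD : measurable D. Proof. exact: (measurable_es_dom R r_uniq rE discF). Qed.

Let mq (B : set F) : measurable B -> measurable_fun D (fun x => q x B).
Proof. exact: (measurable_limit_frequency r_uniq rE). Qed.

Definition coord0 (y : seq_measurableType F) : F := y 0%N.

HB.instance Definition _ :=
  isMeasurableFun.Build _ _ _ _ coord0 (measurable_coord 0).

(** As the law of a coordinate under [h x], the set function given by the limiting
    frequencies is a measure without further proof. *)
Definition es_ker (x : ms_seq F) : subprobability F R := distribution (h x) coord0.

Lemma es_kerE x B : D x -> measurable B -> es_ker x B = (q x B)%:E.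
Proof.
move=> Dx mB; transitivity (h x (cylinder 1 (fun=> B))).
  congr (h x _); apply/seteqP; split => y /=; first by move=> yB [|].
  exact.
by rewrite h_cyl// big_ord_recl big_ord0 mule1.
Qed.

Lemma es_ker_carrier x : D x -> es_ker x (carrier F) = 1%E.
Proof.
move=> Dx; rewrite es_kerE//; last exact: measurable_carrier.
by rewrite (limit_frequency_carrier r_uniq rE).
Qed.

Lemma measurable_es_ker U : measurable U -> measurable_fun D (fun x => es_ker x U).
Proof.
move=> mU; apply: (@eq_measurable_fun _ _ _ _ D (fun x => (q x U)%:E)).
  by move=> x; rewrite inE => Dx; rewrite es_kerE.
by apply/measurable_EFinP; exact: mq.
Qed.

Definition es : pkernel R (ms_seq F) F :=
  PKernel (fun x Dx => proj1 Dx) mD es_ker_carrier measurable_es_ker.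

Lemma measurable_esN_ker U : measurable U -> measurable_fun D (fun x => h x U).
Proof.
move=> mU; apply: measurable_fun_probability_cylinders => // n B mB.
apply: (@eq_measurable_fun _ _ _ _ D (fun x => (\prod_(i < n) q x (B i))%:E)).
  by move=> x; rewrite inE => Dx; rewrite h_cyl// prodEFin.
apply/measurable_EFinP; apply: measurable_prod => i _; exact: mq.
Qed.

Definition esN : pkernel R (ms_seq F) (ms_seq F) :=
  PKernel (pker := fun x => h x : subprobability (ms_seq F) R)
    (fun x Dx => proj1 Dx) mD h_carrier measurable_esN_ker.

Lemma esN_seq_power : is_seq_power es esN.
Proof.
split => // x Dx n B mB; rewrite [LHS]h_cyl//.
by apply: eq_bigr => i _; rewrite [RHS]es_kerE.
Qed.

Lemma es_permutation_invariant : permutation_invariant es.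
Proof.
move=> s fs.
have domE : pdom (Defs.pcomp es (preindex R F s)) = pdom es.
  apply/seteqP; split => x /=.
    move=> [Fx /eqP]; rewrite /pdet_ker/= diracE.
    case: (boolP (_ \in _)); last by rewrite eqe eq_sym oner_eq0.
    by rewrite inE => /(es_dom_perm R r_uniq rE _ fs).
  move=> Dx; split; first exact: (proj1 Dx).
  by rewrite /pdet_ker/= diracE mem_set//; exact/(es_dom_perm R r_uniq rE _ fs).
split => // x; rewrite domE => Dx U mU.
have Dxs : D (x \o s) by exact/(es_dom_perm R r_uniq rE _ fs).
rewrite pcomp_kerE /= integral_dirac//; last exact: measurable_es_ker.
rewrite diracE mem_set// mul1e !es_kerE//.
by rewrite (limit_frequency_perm r_uniq rE).
Qed.

(** Membership in [D] depends on the frequencies of the finitely many letters,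
    each of which converges almost surely. *)
Lemma exchangeable_es_dom d (Y : measurableType d) (V : set Y)
    (mu : subprobability (ms_seq F * Y)%type R) : measurable V ->
  (forall s, finite_perm s -> forall U, measurable U ->
    mu (reindex_fst s @^-1` U) = mu U) ->
  mu (carrier (ms_seq F) `*` V) = 1%E -> mu (D `*` V) = 1%E.
Proof.
move=> mV mu_inv muC.
have mC : measurable (carrier (ms_seq F) `*` V).
  by apply: measurableX => //; exact: measurable_carrier.
have mDV : measurable (D `*` V) by exact: measurableX.
have aeF : Filter (nbhs (almost_everywhere mu)) by exact: _.
have ae_r (t : seq F) : {subset t <= r} ->
    {ae mu, forall z, forall k, k \in t -> cvgn (frequency R [set k] z.1)}.
  elim: t => [_|k t IHt tr]; first exact: aeW.
  have mk : measurable [set k].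
    by apply: discF; apply: (atom_sub rE); apply: tr; exact: mem_head.
  have := ae_cvg_frequency mu_inv mk.
  have : {subset t <= r} by move=> j jt; apply: tr; rewrite inE jt orbT.
  move=> /IHt; apply: filterS2 => z zt zk j.
  by rewrite inE => /orP[/eqP->//|]; exact: zt.
have mu_N : mu (~` (D `*` V)) = 0%E.
  have muC0 := subprobability_carried mC muC.
  apply/(negligibleP mu (measurableC mDV)).
  apply: negligibleS (negligibleU (ae_r r (fun _ => id))
    ((negligibleP mu (measurableC mC)).2 muC0)) => z /= nDV.
  have [[Fz Vz]|nC] := pselect ((carrier (ms_seq F) `*` V) z); last by right.
  left=> /= zr; apply: nDV; split => //=; exact/(es_domP R r_uniq rE).
have muT : mu setT = 1%E.
  apply/eqP; rewrite eq_le sprobability_setT -muC le_measure ?inE//.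
rewrite -muT (measureDI mu measurableT mDV) setTI setTD.
by rewrite [X in (X + _)%E]mu_N add0e.
Qed.

Lemma es_empirically_adequate : empirically_adequate es.
Proof.
exists esN; first exact: esN_seq_power.
move=> A Y _ _ f exf.
have mcY := measurable_carrier Y.
have fDY a : pdom f a -> f a (D `*` carrier Y) = 1%E.
  move=> fa; apply: exchangeable_es_dom => //.
    exact: exchangeable_invariant exf fa.
  exact: pker_carrier fa.
have domE : pdom (Defs.pcomp (ptensor esN (pid R Y)) f) = pdom f.
  by apply/seteqP; split => a /= => [[]//|fa]; split => //; exact: fDY.
split => // a; rewrite domE => fa.
have mu_inv := exchangeable_invariant exf fa.
pose e (B : set F) : ms_seq F -> R := (fun x => q x B) \_ D.
have me B : measurable B -> measurable_fun setT (e B).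
  by move=> mB; apply/(measurable_restrictT _ mD); exact: mq.
have e01 B x : 0 <= e B x <= 1.
  rewrite /e patchE; case: ifPn => [|_]; last by rewrite lexx ler01.
  by rewrite inE => /(limit_frequency01 r_uniq rE).
have e_inv s B x : finite_perm s -> e B (x \o s) = e B x.
  move=> fs; rewrite /e !patchE.
  have Dxs := es_dom_perm R r_uniq rE x fs.
  case: ifPn; rewrite ?inE ?notin_setE => Dx.
    by rewrite mem_set ?(limit_frequency_perm r_uniq rE)//; exact/Dxs.
  by rewrite memNset// => /Dxs.
have mDY : measurable (D `*` carrier Y) by exact: measurableX.
have fN := subprobability_carried mDY (fDY a fa).
have e_lim B : measurable B ->
    {ae f a, forall z, frequency R B z.1 @ \oo --> e B z.1}.
  move=> mB; apply: negligibleS ((negligibleP (f a) (measurableC mDY)).2 fN).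
  move=> z /= nz [/= Dz _]; apply: nz.
  by rewrite /e patchE mem_set//; exact: (cvg_frequency r_uniq rE).
(* On rectangles, both sides are the integral computed in
   [exchangeable_rectangle]. *)
apply: eq_measure_rectangles => n B V mB mV.
rewrite (exchangeable_rectangle mu_inv me e01 e_inv e_lim n mB mV).
pose g (z : ms_seq F * Y) : R := \1_V z.2 * \prod_(i < n) e (B i) z.1.
have mg : measurable_fun setT g.
  apply: measurable_funM.
    by apply: (measurableT_comp (f := \1_V : Y -> R)); first exact: measurable_indic.
  apply: measurable_prod => i _.
  exact: (measurableT_comp (me _ (mB i)) measurable_fst).
have g1 z : `|g z| <= 1.
  have p0 : 0 <= \prod_(i < n) e (B i) z.1.
    by apply: prodr_ge0 => i _; case/andP: (e01 (B i) z.1).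
  have p1 : \prod_(i < n) e (B i) z.1 <= 1 by apply: prodr_ile1 => i _.
  have /andP[v0 v1] : 0 <= (\1_V z.2 : R) <= 1.
    exact: indic_itv01.
  by rewrite ger0_norm ?mulr_ge0// mulr_ile1.
have intg := integrable_bounded (f a) mg g1.
transitivity (\int[f a]_(z in D `*` carrier Y) (g z)%:E)%E.
  apply: eq_integral => z; rewrite inE => -[/= Dz Yz].
  transitivity (h z.1 (cylinder n B) * \d_(z.2) V)%E.
    apply: product_measure1E => //; exact: measurable_cylinder.
  rewrite h_cyl// diracE /g EFinM muleC indicE prodEFin; congr (_ * _%:E)%E.
  by apply: eq_bigr => i _; rewrite /e patchE mem_set.
rewrite /Rintegral fineK; last exact: integrable_fin_num.
rewrite [RHS](negligible_integral (measurableC mDY) _ intg fN)//.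
by rewrite setTD setCK.
Qed.

End empirical_sampling_kernel.

Theorem theorem3p5 (R : realType) (F : mspace)
    (finF : finite_set (carrier F))
    (discF : forall T : set F, T `<=` carrier F -> measurable T) :
  exists es : pkernel R (ms_seq F) F,
    [/\ pdom es = [set x | carrier (ms_seq F) x /\
           forall T : set F, T `<=` carrier F -> cvgn (frequency R T x)],
        forall x, pdom es x -> forall T : set F, T `<=` carrier F ->
          es x T = (limn (frequency R T x))%:E
      & empirical_sampling es].
Proof.
have [t tE] := (finite_seqP _).1 finF.
have r_uniq := undup_uniq t.
have rE : carrier F = [set` undup t].
  by rewrite tE; apply/seteqP; split => k; rewrite /= mem_undup.
have [h hP] := exists_limit_law R r_uniq rE.
pose h_cyl x Dx := (hP x Dx).1; pose h_carrier x Dx := (hP x Dx).2.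
exists (es r_uniq rE discF h_cyl); split => //.
- move=> x Dx T TF; rewrite [LHS](es_kerE h_cyl Dx (discF T TF)).
  by congr (_%:E); apply/esym/cvg_lim => //; exact: (cvg_frequency r_uniq rE).
- split; first exact: es_permutation_invariant.
  exact: es_empirically_adequate.
Qed.
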